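(* Let $\mathbb{G}$ be a finite quantum group. Then there is an undirected finite quantum graph $\mathcal{G}$ such that $\mathbb{G}\cong\operatorname{Qut}(\mathcal{G})$. That is, $\mathbb{G}$ acts faithfully on $\mathcal{G}$, and the canonical quotient map $C(\operatorname{Qut}(\mathcal{G}))\to C(\mathbb{G})$ is an isomorphism of Hopf $*$-algebras.
   Context: A finite quantum group $\mathbb{G}$ is given by a finite-dimensional C*-algebra $C(\mathbb{G})$ that is a CQG Hopf $*$-algebra (comultiplication $\Delta$). A finite quantum set $\mathbb{X}$ is a finite-dimensional C*-algebra $C(\mathbb{X})$ equipped with the unique tracial positive functional $\psi$ (the tracial 1-form) such that, for the inner product $\langle x,y\rangle=\psi(x^*y)$ on $\ell^2(\mathbb{X}):=C(\mathbb{X})$, the multiplication $m:C(\mathbb{X})\otimes C(\mathbb{X})\to C(\mathbb{X})$ satisfies $mm^*=\mathrm{id}$. Let $\eta\in\ell^2(\mathbb{X})$ be the unit. For linear maps $A,B$ on $\ell^2(\mathbb{X})$ the Schur product is $A\bullet B=m(A\otimes B)m^*$ and $\bar A f=(A(f^* ))^*$. A (directed) quantum graph is a pair $(\mathbb{X},A)$ with $A\bullet A=A=\bar A$; it is undirected if $A=A^*$ (Hilbert space adjoint). Its quantum automorphism group $\operatorname{Qut}(\mathbb{X},A)$ is the compact matrix quantum group whose Hopf $*$-algebra is the universal $*$-algebra generated by the entries $u_{ij}$ of a matrix $U$ (with respect to an orthonormal basis of $\ell^2(\mathbb{X})$) subject to: $U$ unitary, $m(U\otimes U)=Um$, $U\eta=\eta$,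 $UA=AU$, with $\Delta(u_{ij})=\sum_k u_{ik}\otimes u_{kj}$; equivalently it is the universal compact quantum group with a $\psi$-preserving action $\alpha$ on $C(\mathbb{X})$ satisfying $(A\otimes\mathrm{id})\alpha=\alpha A$. Here $\mathcal{G}$ lives on a finite quantum set and $\mathbb{G}$ acts on it, with a canonical quotient map from $C(\operatorname{Qut}(\mathcal{G}))$ onto $C(\mathbb{G})$ given by universality. *)

(* Defs.v *)
From mathcomp Require Import all_boot all_algebra.
From mathcomp Require Import reals.
From mathcomp.real_closed Require Export complex.

Set Implicit Arguments.
Unset Strict Implicit.
Unset Printing Implicit Defensive.

Import GRing.Theory Num.Theory.
Local Open Scope ring_scope.

Section QuantumDefs.
Variable R : realType.
Local Notation C := (R[i]).

(* Generic complex unital *-algebras (possibly infinite dimensional),  *)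
(* used to express universal *-algebras through their universal        *)
(* property.                                                           *)
Record starOps := StarOps {
  sa_car   : Type;
  sa_zero  : sa_car;
  sa_one   : sa_car;
  sa_add   : sa_car -> sa_car -> sa_car;
  sa_scale : C -> sa_car -> sa_car;
  sa_mul   : sa_car -> sa_car -> sa_car;
  sa_star  : sa_car -> sa_car }.
Arguments sa_zero : clear implicits.
Arguments sa_one : clear implicits.
Arguments sa_add : clear implicits.
Arguments sa_scale : clear implicits.
Arguments sa_mul : clear implicits.
Arguments sa_star : clear implicits.

Definition is_star_alg (B : starOps) : Prop :=
  let T := sa_car B in
  let add := sa_add B in let mul := sa_mul B in let sc := sa_scale B in
  let st := sa_star B in let z := sa_zero B in let o := sa_one B in
  ((forall x y w : T, add x (add y w) = add (add x y) w) /\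
   (forall x y : T, add x y = add y x) /\
   (forall x : T, add z x = x) /\
   (forall x : T, add x (sc (-1) x) = z) /\
   (forall x : T, sc 1 x = x) /\
   (forall (a b : C) (x : T), sc a (sc b x) = sc (a * b) x) /\
   (forall (a : C) (x y : T), sc a (add x y) = add (sc a x) (sc a y)) /\
   (forall (a b : C) (x : T), sc (a + b) x = add (sc a x) (sc b x))) /\
  ((forall x y w : T, mul x (mul y w) = mul (mul x y) w) /\
   (forall x : T, mul o x = x) /\
   (forall x : T, mul x o = x) /\
   (forall x y w : T, mul (add x y) w = add (mul x w) (mul y w)) /\
   (forall x y w : T, mul x (add y w) = add (mul x y) (mul x w)) /\
   (forall (a : C) (x y : T), mul (sc a x) y = sc a (mul x y)) /\
   (forall (a : C) (x y : T), mul x (sc a y) = sc a (mul x y))) /\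
  ((forall x : T, st (st x) = x) /\
   (forall x y : T, st (add x y) = add (st x) (st y)) /\
   (forall (a : C) (x : T), st (sc a x) = sc (Num.conj a) (st x)) /\
   (forall x y : T, st (mul x y) = mul (st y) (st x))).

Definition is_star_hom (A B : starOps) (f : sa_car A -> sa_car B) : Prop :=
  [/\ (forall x y, f (sa_add A x y) = sa_add B (f x) (f y)),
      (forall a x, f (sa_scale A a x) = sa_scale B a (f x)),
      (forall x y, f (sa_mul A x y) = sa_mul B (f x) (f y)),
      (forall x, f (sa_star A x) = sa_star B (f x)) &
      f (sa_one A) = sa_one B].

Arguments is_star_hom : clear implicits.

Definition sa_sum (B : starOps) (n : nat) (F : 'I_n -> sa_car B) : sa_car B :=
  \big[sa_add B / sa_zero B]_(i < n) F i.

(* Coordinates.  A finite-dimensional vector space is C^d = 'cV_d;     *)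
(* C^m (x) C^n is C^(m*n) with e_i (x) e_j = e_(mxvec_index i j).      *)
Definition tens m n (x : 'cV[C]_m) (y : 'cV[C]_n) : 'cV[C]_(m * n) :=
  (mxvec (x *m y^T))^T.

Definition kron m n (A : 'M[C]_m) (B : 'M[C]_n) : 'M[C]_(m * n) :=
  \sum_(i < m) \sum_(j < n) \sum_(k < m) \sum_(l < n)
     (A i k * B j l) *: delta_mx (mxvec_index i j) (mxvec_index k l).

Definition adj m n (A : 'M[C]_(m, n)) : 'M[C]_(n, m) := (map_mx Num.conj A)^T.

Definition ev n (i : 'I_n) : 'cV[C]_n := delta_mx i 0.

(* A finite-dimensional *-algebra in coordinates: multiplication matrix
   mu (x.y = mu (x (x) y)), unit vector u, and conjugate-linear star
   x^* = J (conj x). *)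
Record fdalg (d : nat) := FDAlg {
  fd_mu : 'M[C]_(d, d * d);
  fd_unit : 'cV[C]_d;
  fd_J : 'M[C]_d }.

Definition fd_mul d (A : fdalg d) (x y : 'cV[C]_d) : 'cV[C]_d :=
  fd_mu A *m tens x y.
Definition fd_star d (A : fdalg d) (x : 'cV[C]_d) : 'cV[C]_d :=
  fd_J A *m map_mx Num.conj x.

Definition fd_ops d (A : fdalg d) : starOps :=
  @StarOps ('cV[C]_d) 0 (fd_unit A) (fun x y => x + y) (fun a x => a *: x)
    (@fd_mul d A) (@fd_star d A).

(* Finite quantum groups: finite-dimensional C*-algebra C(G) (a nonzero *)
(* *-algebra admitting a faithful positive functional) with a          *)
(* coassociative unital *-homomorphism  Delta : C(G) -> C(G) (x) C(G)  *)
(* satisfying the (Woronowicz) cancellation laws.                       *)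
Record fqgroup := FQGroup {
  fqg_dim : nat;
  fqg_alg : fdalg fqg_dim;
  fqg_Delta : 'M[C]_(fqg_dim * fqg_dim, fqg_dim) }.

Section FQG.
Variable G : fqgroup.
Local Notation d := (fqg_dim G).
Local Notation A := (fqg_alg G).
Local Notation D := (fqg_Delta G).

Definition fqg_mul2 (z w : 'cV[C]_(d * d)) : 'cV[C]_(d * d) :=
  \sum_(i < d) \sum_(j < d) \sum_(k < d) \sum_(l < d)
    (z (mxvec_index i j) 0 * w (mxvec_index k l) 0) *:
      tens (fd_mul A (ev i) (ev k)) (fd_mul A (ev j) (ev l)).
Definition fqg_star2 (z : 'cV[C]_(d * d)) : 'cV[C]_(d * d) :=
  \sum_(i < d) \sum_(j < d)
    Num.conj (z (mxvec_index i j) 0) *: tens (fd_star A (ev i)) (fd_star A (ev j)).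

Definition Dc (a p q : 'I_d) : C := D (mxvec_index p q) a.

Definition is_fqgroup : Prop :=
  [/\ is_star_alg (fd_ops A),
      fd_unit A != 0,
      (* C*-algebra: existence of a faithful positive functional *)
      (exists h : 'rV[C]_d, forall x : 'cV[C]_d, x != 0 ->
          0 < (h *m fd_mul A (fd_star A x) x) 0 0),
      [/\ D *m fd_unit A = tens (fd_unit A) (fd_unit A),
          (forall x y, D *m fd_mul A x y = fqg_mul2 (D *m x) (D *m y)) &
          (forall x, D *m fd_star A x = fqg_star2 (D *m x))] &
      (forall a p q r : 'I_d,
          \sum_(i < d) Dc a i r * Dc i p q = \sum_(j < d) Dc a p j * Dc j q r) /\
      (forall z : 'cV[C]_(d * d), exists c : 'M[C]_d,
          z = \sum_(a < d) \sum_(b < d)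
                c a b *: fqg_mul2 (D *m ev a) (tens (fd_unit A) (ev b))) /\
      (forall z : 'cV[C]_(d * d), exists c : 'M[C]_d,
          z = \sum_(a < d) \sum_(b < d)
                c a b *: fqg_mul2 (D *m ev a) (tens (ev b) (fd_unit A)))].

End FQG.

(* Finite quantum sets, written in an orthonormal basis of l^2(X)      *)
(* (inner product <x,y> = psi(x^* y)).  psi(x) = <eta, x>.             *)
Section QSet.
Variable n : nat.
Variable X : fdalg n.
Local Notation m := (fd_mu X).
Local Notation eta := (fd_unit X).

Definition psi (x : 'cV[C]_n) : C := (adj eta *m x) 0 0.

Definition is_qset : Prop :=
  [/\ is_star_alg (fd_ops X),
      eta != 0,
      (forall x y, psi (fd_mul X (fd_star X x) y) = (adj x *m y) 0 0),
      (forall x y, psi (fd_mul X x y) = psi (fd_mul X y x)) &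
      m *m adj m = 1%:M].

Definition schur (A B : 'M[C]_n) : 'M[C]_n := m *m kron A B *m adj m.

Definition qbar (A : 'M[C]_n) (f : 'cV[C]_n) : 'cV[C]_n :=
  fd_star X (A *m fd_star X f).

Definition is_qgraph (A : 'M[C]_n) : Prop :=
  schur A A = A /\ (forall f, qbar A f = A *m f).

Definition is_undirected_qgraph (A : 'M[C]_n) : Prop :=
  is_qgraph A /\ A = adj A.

(* The defining relations of Qut(X, A) for a matrix V with entries in a
   *-algebra B:  V unitary, m (V (x) V) = V m, V eta = eta, V A = A V. *)
Definition qut_rel (A : 'M[C]_n) (B : starOps) (V : 'I_n -> 'I_n -> sa_car B)
    : Prop :=
  let add := sa_add B in let mul := sa_mul B in let sc := sa_scale B in
  let st := sa_star B in
  [/\ (forall i j, sa_sum (fun k => mul (V i k) (st (V j k)))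
                    = sc (if i == j then 1 else 0) (sa_one B)),
      (forall i j, sa_sum (fun k => mul (st (V k i)) (V k j))
                    = sc (if i == j then 1 else 0) (sa_one B)),
      (forall (p k l : 'I_n),
          sa_sum (fun i => sa_sum (fun j =>
              sc (m p (mxvec_index i j)) (mul (V i k) (V j l))))
          = sa_sum (fun q => sc (m q (mxvec_index k l)) (V p q))),
      (forall i, sa_sum (fun j => sc (eta j 0) (V i j)) = sc (eta i 0) (sa_one B)) &
      (forall i j, sa_sum (fun k => sc (A k j) (V i k))
                   = sa_sum (fun k => sc (A i k) (V k j)))].
End QSet.
Arguments qut_rel {n} X A B V.

(* Actions and the quantum automorphism group.                         *)
(* u i j in C(G) is the matrix of the action                            *)
(* alpha(e_j) = sum_i e_i (x) u i j.                                    *)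
Section Qut.
Variable G : fqgroup.
Local Notation d := (fqg_dim G).
Local Notation AG := (fqg_alg G).
Variable n : nat.
Variable X : fdalg n.
Variable A : 'M[C]_n.
Variable u : 'I_n -> 'I_n -> 'cV[C]_d.

Definition is_graph_action : Prop :=
  qut_rel X A (fd_ops AG) u /\
  forall i j, fqg_Delta G *m u i j = \sum_(k < n) tens (u i k) (u k j).

(* faithful: the u_ij generate C(G) as a *-algebra *)
Definition action_faithful : Prop :=
  forall P : 'cV[C]_d -> Prop,
    P (fd_unit AG) ->
    (forall x y, P x -> P y -> P (x + y)) ->
    (forall (c : C) x, P x -> P (c *: x)) ->
    (forall i j x, P x -> P (fd_mul AG (u i j) x) /\
                          P (fd_mul AG (fd_star AG (u i j)) x)) ->
    forall x, P x.

(* the canonical surjection C(Qut(X,A)) -> C(G), u^Qut_ij |-> u_ij, is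
   injective: stated through the universal property of the universal
   *-algebra C(Qut(X,A)): every matrix V over any *-algebra B satisfying
   the Qut relations is the image of u under a unital *-homomorphism
   C(G) -> B. *)
Definition action_universal : Prop :=
  forall (B : starOps), is_star_alg B ->
  forall V : 'I_n -> 'I_n -> sa_car B, qut_rel X A B V ->
  exists pi : 'cV[C]_d -> sa_car B,
    is_star_hom (fd_ops AG) B pi /\ (forall i j, pi (u i j) = V i j).

End Qut.

End QuantumDefs.

Arguments is_graph_action {R} G {n} X A u.
Arguments action_faithful {R} G {n} u.
Arguments action_universal {R} G {n} X A u.
Arguments qut_rel {R n} X A B V.
Arguments is_star_hom {R} A B f.

(* Main.v *)
(* Let H = C(G), let psi be the trace of the left regular representation and
   e_i an orthonormal basis for it.  The coproduct is encoded by the matrix u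
   over H with Delta (e_j) = sum_i e_i (x) u_ij.  The cancellation laws make u
   invertible, which gives psi * psi = d psi; so psi is a multiple of the Haar
   state and u is unitary.

   For a in H let T_a = (psi (a -) (x) id) Delta.  These operators commute with
   u, the Schur product of T_a and T_b is T_(ba), and T_a is real when a = a^*.
   Hence T_p is a quantum graph for every projection p.  Conversely, if a
   quantum permutation V of H commutes with all T_a, then V is the image of u
   under (eps (x) id) alpha, where eps is the counit and alpha the action given
   by V.  By the spectral theorem finitely many projections p span H, so it is
   enough to encode finitely many T_p into one undirected graph.  This is done
   on 2L disjoint copies of H.  Half of them carry loops, and a half-graph of
   complete blocks between the two halves gives all copies different degrees,
   so that V preserves each copy.  Blocks equal to the identity force V to be
   the same on all copies, and the remaining blocks contain the T_p. *)

From HB Require Import structures.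
Require Import Defs.
From mathcomp Require Import all_boot all_order all_algebra.
From mathcomp Require Import boolp reals.
From mathcomp Require Import ring.
From mathcomp.real_closed Require Import complex.

Set Implicit Arguments.
Unset Strict Implicit.
Unset Printing Implicit Defensive.

Import Order.TTheory GRing.Theory Num.Theory.
Local Open Scope ring_scope.

(** * Star-algebras and matrices over them *)

(** The target B of the universal property is an arbitrary *-algebra, without norm or positivity, so
    everything about V must come from operators that commute with it. These are closed under sums,
    products, adjoints and Schur products, and they contain left multiplication by any vector that V
    fixes. Hence V is block diagonal as soon as it fixes a vector with distinct scalar values on the
    copies. Positivity and faithfulness of psi are used in C(G) only.

    T_p need not be self-adjoint, so by itself it is a directed graph. Placed between two different
    copies, with its adjoint in the transposed block, it becomes undirected. The degrees which this
    creates depend on the projections; the copies are therefore told apart by counting only the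
    edges between looped and unlooped copies, whose number can be prescribed. *)

Record starAlg (R : realType) := StarAlg {
  sal :> algType R[i];
  st : sal -> sal;
  stK : involutive st;
  stD : {morph st : x y / x + y};
  stZ : forall a x, st (a *: x) = Num.conj a *: st x;
  stM : forall x y, st (x * y) = st y * st x }.
Arguments st {R s} x.

Section Carrier.
Variables (R : realType) (B : starOps R).

(* The proofs are phantom arguments: the algebra structure that they provide is
   attached to this alias as canonical instances. *)
Definition carrier (_ : is_star_alg B) (_ : sa_one B <> sa_zero B) : Type :=
  sa_car B.

Variables (hB : is_star_alg B) (nz : sa_one B <> sa_zero B).
Local Notation T := (carrier hB nz).

HB.instance Definition _ := gen_eqMixin T.
HB.instance Definition _ := gen_choiceMixin T.

Let add : T -> T -> T := @sa_add R B.
Let mul : T -> T -> T := @sa_mul R B.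
Let scale : R[i] -> T -> T := @sa_scale R B.

Fact carrier_addA : associative add.
Proof. by have [[H _] _] := hB; move=> x y z; apply: H. Qed.
Fact carrier_addC : commutative add.
Proof. by have [[_ [H _]] _] := hB; move=> x y; apply: H. Qed.
Fact carrier_add0 : left_id (sa_zero B : T) add.
Proof. by have [[_ [_ [H _]]] _] := hB; move=> x; apply: H. Qed.
Fact carrier_addN : left_inverse (sa_zero B : T) (scale (-1)) add.
Proof.
by move=> x; rewrite carrier_addC; have [[_ [_ [_ [H _]]]] _] := hB; apply: H.
Qed.
HB.instance Definition _ := GRing.isZmodule.Build T
  carrier_addA carrier_addC carrier_add0 carrier_addN.

Fact carrier_mulA : associative mul.
Proof. by have [_ [[H _] _]] := hB; move=> x y z; apply: H. Qed.
Fact carrier_mul1 : left_id (sa_one B : T) mul.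
Proof. by have [_ [[_ [H _]] _]] := hB; move=> x; apply: H. Qed.
Fact carrier_1mul : right_id (sa_one B : T) mul.
Proof. by have [_ [[_ [_ [H _]]] _]] := hB; move=> x; apply: H. Qed.
Fact carrier_mulDl : left_distributive mul +%R.
Proof. by have [_ [[_ [_ [_ [H _]]]] _]] := hB; move=> x y z; apply: H. Qed.
Fact carrier_mulDr : right_distributive mul +%R.
Proof. by have [_ [[_ [_ [_ [_ [H _]]]]] _]] := hB; move=> x y z; apply: H. Qed.
Fact carrier_nz : (sa_one B : T) != 0.
Proof. exact/eqP. Qed.
HB.instance Definition _ := GRing.Zmodule_isNzRing.Build T
  carrier_mulA carrier_mul1 carrier_1mul carrier_mulDl carrier_mulDr carrier_nz.

Fact carrier_scaleA a b (v : T) : scale a (scale b v) = scale (a * b) v.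
Proof. by have [[_ [_ [_ [_ [_ [H _]]]]]] _] := hB; apply: H. Qed.
Fact carrier_scale1 : left_id 1 scale.
Proof. by have [[_ [_ [_ [_ [H _]]]]] _] := hB; move=> x; apply: H. Qed.
Fact carrier_scaleDr : right_distributive scale +%R.
Proof. by have [[_ [_ [_ [_ [_ [_ [H _]]]]]]] _] := hB; move=> a x y;
  apply: H. Qed.
Fact carrier_scaleDl (v : T) : {morph scale^~ v : a b / a + b}.
Proof. by have [[_ [_ [_ [_ [_ [_ [_ H]]]]]]] _] := hB; move=> a b;
  apply: H. Qed.
HB.instance Definition _ := GRing.Zmodule_isLmodule.Build R[i] T
  carrier_scaleA carrier_scale1 carrier_scaleDr carrier_scaleDl.

Fact carrier_scaleAl a (u v : T) : a *: (u * v) = (a *: u) * v.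
Proof. by have [_ [[_ [_ [_ [_ [_ [H _]]]]]] _]] := hB; symmetry; apply: H. Qed.
HB.instance Definition _ := GRing.Lmodule_isLalgebra.Build R[i] T
  carrier_scaleAl.

Fact carrier_scaleAr a (u v : T) : a *: (u * v) = u * (a *: v).
Proof. by have [_ [[_ [_ [_ [_ [_ [_ H]]]]]] _]] := hB; symmetry; apply: H. Qed.
HB.instance Definition _ := GRing.Lalgebra_isAlgebra.Build R[i] T
  carrier_scaleAr.

Definition carrier_star : starAlg R.
Proof.
refine (@StarAlg R T (@sa_star R B) _ _ _ _).
- by have [_ [_ [H _]]] := hB; move=> x; apply: H.
- by have [_ [_ [_ [H _]]]] := hB; move=> x y; apply: H.
- by have [_ [_ [_ [_ [H _]]]]] := hB; move=> a x; apply: H.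
- by have [_ [_ [_ [_ [_ H]]]]] := hB; move=> x y; apply: H.
Defined.

End Carrier.

Section StarAlgTheory.
Variables (R : realType) (B : starAlg R).
Local Notation C := R[i].
Implicit Types x y : B.

Lemma st0 : st (0 : B) = 0.
Proof. by apply: (addrI (st 0)); rewrite -stD !addr0. Qed.

Lemma st1 : st (1 : B) = 1.
Proof. by have := stM (st (1 : B)) 1; rewrite !mulr1 stK mulr1 => <-. Qed.

Lemma st_sum (I : Type) (r : seq I) (P : pred I) (F : I -> B) :
  st (\sum_(i <- r | P i) F i) = \sum_(i <- r | P i) st (F i).
Proof. by apply: (big_morph st (@stD _ _)); exact: st0. Qed.

Lemma st_scalar (a : C) : st (a%:A : B) = (Num.conj a)%:A.
Proof. by rewrite stZ st1. Qed.

(* Matrices over the noncommutative algebra B: [emb] embeds scalar matrices,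
   [dag] is the conjugate transpose. *)
Definition emb m n (A : 'M[C]_(m, n)) : 'M[B]_(m, n) := map_mx (in_alg B) A.
Definition dag m n (X : 'M[B]_(m, n)) : 'M[B]_(n, m) := (map_mx st X)^T.

Lemma embM m n p (X : 'M[C]_(m, n)) (Y : 'M_(n, p)) :
  emb (X *m Y) = emb X *m emb Y.
Proof. exact: map_mxM. Qed.

Lemma emb1 n : emb (1%:M : 'M_n) = 1%:M.
Proof. exact: map_mx1. Qed.

Lemma embE m n (X : 'M[C]_(m, n)) i j : emb X i j = (X i j)%:A.
Proof. by rewrite mxE. Qed.

Lemma mul_embE m n p (X : 'M[C]_(m, n)) (Y : 'M[B]_(n, p)) i k :
  (emb X *m Y) i k = \sum_j X i j *: Y j k.
Proof. by rewrite mxE; apply: eq_bigr => j _; rewrite embE mulr_algl. Qed.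

Lemma mulE_emb m n p (X : 'M[B]_(m, n)) (Y : 'M[C]_(n, p)) i k :
  (X *m emb Y) i k = \sum_j Y j k *: X i j.
Proof. by rewrite mxE; apply: eq_bigr => j _; rewrite embE mulr_algr. Qed.

Lemma dagE m n (X : 'M[B]_(m, n)) i j : dag X i j = st (X j i).
Proof. by rewrite !mxE. Qed.

Lemma dagK m n (X : 'M[B]_(m, n)) : dag (dag X) = X.
Proof. by apply/matrixP => i j; rewrite !dagE stK. Qed.

Lemma dagM m n p (X : 'M[B]_(m, n)) (Y : 'M[B]_(n, p)) :
  dag (X *m Y) = dag Y *m dag X.
Proof.
apply/matrixP => i k; rewrite dagE !mxE st_sum.
by apply: eq_bigr => j _; rewrite !dagE stM.
Qed.

Lemma dag_emb m n (X : 'M[C]_(m, n)) : dag (emb X) = emb (adj X).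
Proof. by apply/matrixP => i j; rewrite dagE !embE st_scalar !mxE. Qed.

End StarAlgTheory.

Lemma adj_mxK (R : realType) m n (A : 'M[R[i]]_(m, n)) : adj (adj A) = A.
Proof. by apply/matrixP => i j; rewrite !mxE conjCK. Qed.

Lemma adj_mulmx (R : realType) m n p (A : 'M[R[i]]_(m, n)) (B : 'M_(n, p)) :
  adj (A *m B) = adj B *m adj A.
Proof. by rewrite /adj map_mxM trmx_mul. Qed.

Lemma adj_mx1 (R : realType) n : adj (1%:M : 'M[R[i]]_n) = 1%:M.
Proof. by rewrite /adj map_mx1 trmx1. Qed.

Section PairIndex.
Variables m n : nat.

Definition unpair_idx (s : 'I_(m * n)) : 'I_m * 'I_n :=
  enum_val (cast_ord (esym (mxvec_cast m n)) s).

Lemma unpair_idxE i j : unpair_idx (mxvec_index i j) = (i, j).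
Proof. by rewrite /unpair_idx /mxvec_index cast_ordK enum_rankK. Qed.

Lemma unpair_idxK s : mxvec_index (unpair_idx s).1 (unpair_idx s).2 = s.
Proof. by case/mxvec_indexP: s => i j; rewrite unpair_idxE. Qed.

Lemma sum_mxvec (V : nmodType) (F : 'I_(m * n) -> V) :
  \sum_s F s = \sum_i \sum_j F (mxvec_index i j).
Proof.
rewrite pair_bigA (reindex (fun p => mxvec_index p.1 p.2)) //=.
exists (@unpair_idx) => [[i j] _|s _]; first by rewrite unpair_idxE.
by rewrite unpair_idxK.
Qed.

Lemma mxvec_index_eq i j k l :
  (mxvec_index i j == mxvec_index k l :> 'I_(m * n)) = (i == k) && (j == l).
Proof.
apply/eqP/andP => [H|[/eqP-> /eqP->]//].
by have := congr1 unpair_idx H; rewrite !unpair_idxE => -[-> ->].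
Qed.
End PairIndex.

Lemma kronE (R : realType) m n (A : 'M[R[i]]_m) (B : 'M_n) i j k l :
  kron A B (mxvec_index i j) (mxvec_index k l) = A i k * B j l.
Proof.
rewrite /kron summxE (bigD1 i) //= [X in _ + X]big1 ?addr0; last first.
  move=> i' ni; rewrite summxE big1 // => j' _; rewrite summxE big1 // => k' _.
  rewrite summxE big1 // => l' _; rewrite !mxE !mxvec_index_eq.
  by rewrite [i == _]eq_sym (negbTE ni) /= mulr0.
rewrite summxE (bigD1 j) //= [X in _ + X]big1 ?addr0; last first.
  move=> j' nj; rewrite summxE big1 // => k' _; rewrite summxE big1 // => l' _.
  by rewrite !mxE !mxvec_index_eq [j == _]eq_sym (negbTE nj) andbF mulr0.
rewrite summxE (bigD1 k) //= [X in _ + X]big1 ?addr0; last first.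
  move=> k' nk; rewrite summxE big1 // => l' _.
  by rewrite !mxE !mxvec_index_eq [k == _]eq_sym (negbTE nk) andbF mulr0.
rewrite summxE (bigD1 l) //= [X in _ + X]big1 ?addr0; last first.
  move=> l' nl.
  by rewrite !mxE !mxvec_index_eq [l == _]eq_sym (negbTE nl) !andbF mulr0.
by rewrite !mxE !mxvec_index_eq !eqxx mulr1.
Qed.

Lemma tensE (R : realType) m n (x : 'cV[R[i]]_m) (y : 'cV_n) i j k :
  tens x y (mxvec_index i j) k = x i 0 * y j 0.
Proof. by rewrite mxE ord1 mxvecE !mxE big_ord1 !mxE. Qed.

(** * Finite quantum sets in an orthonormal basis *)

(* [tau_trace] says that [tau] is the trace of the left regular
   representation, which encodes the normalisation m m^* = id. *)
Record frame (R : realType) (n : nat) := Frame {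
  fal :> starAlg R;
  tau : fal -> R[i];
  fe : 'I_n -> fal;
  tau_scalar : scalar tau;
  tauC : forall x y, tau (x * y) = tau (y * x);
  tau_st : forall x, tau (st x) = Num.conj (tau x);
  tau_onb : forall i j, tau (st (fe i) * fe j) = (i == j)%:R;
  frame_exp : forall x, x = \sum_i tau (st (fe i) * x) *: fe i;
  tau_trace : forall x, \sum_i tau (st (fe i) * x * fe i) = tau x }.
Arguments tau {R n f} x.
Arguments fe {R n f} i.

HB.instance Definition _ (R : realType) n (F : frame R n) :=
  GRing.isLinear.Build R[i] (fal F) R[i] *%R (@tau R n F) (@tau_scalar R n F).

Section FrameTheory.
Variables (R : realType) (n : nat) (F : frame R n).
Local Notation C := R[i].
Local Notation e := (@fe R n F).
Implicit Types (x y z : F) (a : C).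

Lemma tauD x y : tau (x + y) = tau x + tau y.
Proof. exact: linearD. Qed.
Lemma tauZ a x : tau (a *: x) = a * tau x.
Proof. exact: linearZ. Qed.
Lemma tau_sum (I : Type) (r : seq I) (P : pred I) (G : I -> F) :
  tau (\sum_(i <- r | P i) G i) = \sum_(i <- r | P i) tau (G i).
Proof. exact: linear_sum. Qed.

Definition co (i : 'I_n) x : C := tau (st (e i) * x).

Lemma co_scalar i : scalar (co i).
Proof. by move=> a x y; rewrite /co mulrDr -scalerAr linearP. Qed.
HB.instance Definition _ i :=
  GRing.isLinear.Build C F C *%R (co i) (co_scalar i).

Lemma coD i x y : co i (x + y) = co i x + co i y.
Proof. exact: linearD. Qed.
Lemma coZ i a x : co i (a *: x) = a * co i x.
Proof. exact: linearZ. Qed.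
Lemma co0 i : co i 0 = 0.
Proof. exact: linear0. Qed.
Lemma co_sum k (I : Type) (r : seq I) (P : pred I) (G : I -> F) :
  co k (\sum_(i <- r | P i) G i) = \sum_(i <- r | P i) co k (G i).
Proof. exact: linear_sum. Qed.

Lemma co_e i j : co i (e j) = (i == j)%:R.
Proof. exact: tau_onb. Qed.

Lemma co_exp x : x = \sum_i co i x *: e i.
Proof. exact: frame_exp. Qed.

Lemma conj_co i x : Num.conj (co i x) = tau (st x * e i).
Proof. by rewrite -tau_st stM stK. Qed.

Lemma parseval x y : \sum_i tau (x * e i) * co i y = tau (x * y).
Proof.
rewrite [in RHS](co_exp y) mulr_sumr tau_sum; apply: eq_bigr => i _.
by rewrite -scalerAr tauZ mulrC.
Qed.

Lemma co_lift (U : lmodType C) (f : F -> U) : linear f ->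
  forall x, f x = \sum_i co i x *: f (e i).
Proof.
move=> fl x; pose g : {linear F -> U} := HB.pack f
  (GRing.isLinear.Build C F U *:%R f fl).
rewrite {1}(co_exp x); transitivity (g (\sum_i co i x *: e i)); first by [].
by rewrite linear_sum; apply: eq_bigr => i _; rewrite linearZ.
Qed.

Lemma co_inj x y : (forall i, co i x = co i y) -> x = y.
Proof.
by move=> xy; rewrite (co_exp x) (co_exp y); apply: eq_bigr => i _; rewrite xy.
Qed.

Lemma co_st i j : co i (st (e j)) = co j (st (e i)).
Proof. by rewrite /co tauC. Qed.

Lemma tau_inj x y : (forall z, tau (z * x) = tau (z * y)) -> x = y.
Proof. by move=> H; apply: co_inj => i; apply: H. Qed.

Lemma tau_pos x : tau (st x * x) = \sum_i `|co i x| ^+ 2.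
Proof.
rewrite -parseval; apply: eq_bigr => i _.
by rewrite -conj_co normCK mulrC.
Qed.

Lemma tau_eq0 x : tau (st x * x) = 0 -> x = 0.
Proof.
rewrite tau_pos => /eqP; rewrite psumr_eq0 => [/allP H|i _]; last first.
  exact: exprn_ge0.
apply: co_inj => i; rewrite co0; apply/eqP.
by have := H i (mem_index_enum i); rewrite /= expf_eq0 /= => /eqP/normr0_eq0 ->.
Qed.

(** Faithfulness of [tau] turns the trace formula [tau_trace] into an identity in the algebra. In
    this form the normalisation of [tau] enters m m^* = id. *)
Lemma sum_ee : \sum_i e i * st (e i) = 1.
Proof.
apply: tau_inj => x; rewrite mulr1 mulr_sumr tau_sum -[RHS]tau_trace.
by apply: eq_bigr => i _; rewrite mulrA tauC mulrA.
Qed.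

Lemma tau1 : tau (1 : F) = n%:R.
Proof.
rewrite -tau_trace; under eq_bigr do rewrite mulr1 tau_onb eqxx.
by rewrite sumr_const card_ord.
Qed.

Lemma tau1_neq0 : tau (1 : F) != 0.
Proof.
apply/eqP => H; have /tau_eq0 /eqP : tau (st 1 * 1 : F) = 0
  by rewrite st1 mulr1.
by rewrite oner_eq0.
Qed.

Definition sc p q r := co p (e q * e r).

Definition frame_alg : fdalg R n := FDAlg
  (\matrix_(p, s) sc p (unpair_idx s).1 (unpair_idx s).2)
  (\col_i co i 1)
  (\matrix_(i, j) co i (st (e j))).

Local Notation X := frame_alg.
Local Notation m := (fd_mu X).
Local Notation eta := (fd_unit X).

Definition vec (x : 'cV[C]_n) : F := \sum_i x i 0 *: e i.

Lemma co_vec i (v : 'cV[C]_n) : co i (vec v) = v i 0.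
Proof.
rewrite co_sum (bigD1 i) //= coZ co_e eqxx mulr1 big1 ?addr0 // => j.
by move=> ji; rewrite coZ co_e eq_sym (negbTE ji) mulr0.
Qed.

Lemma vec_inj : injective vec.
Proof.
by move=> x y xy; apply/matrixP => i j; rewrite ord1 -!co_vec xy.
Qed.

Lemma vec_col x : vec (\col_i co i x) = x.
Proof. by apply: co_inj => i; rewrite co_vec mxE. Qed.

Lemma vec_linear : linear vec.
Proof.
move=> a x y; apply: co_inj => i.
by rewrite co_vec coD coZ !co_vec !mxE.
Qed.

Lemma vecD (x y : 'cV[C]_n) : vec (x + y) = vec x + vec y.
Proof. by rewrite -[x in LHS]scale1r vec_linear scale1r. Qed.
Lemma vec0 : vec 0 = 0.
Proof. by apply: (addrI (vec 0)); rewrite -vecD !addr0. Qed.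
Lemma vecZ a (x : 'cV[C]_n) : vec (a *: x) = a *: vec x.
Proof. by rewrite -[a *: x]addr0 vec_linear vec0 addr0. Qed.

Lemma frame_muE p q r : m p (mxvec_index q r) = sc p q r.
Proof. by rewrite mxE unpair_idxE. Qed.

Lemma vec_mul (x y : 'cV[C]_n) : vec (fd_mul X x y) = vec x * vec y.
Proof.
apply: co_inj => p; rewrite co_vec mxE sum_mxvec mulr_suml co_sum.
apply: eq_bigr => i _; rewrite mulr_sumr co_sum; apply: eq_bigr => j _.
by rewrite frame_muE tensE -scalerAr -scalerAl !coZ mulrC [y j 0 * _]mulrCA
  -mulrA.
Qed.

Lemma vec_star (x : 'cV[C]_n) : vec (fd_star X x) = st (vec x).
Proof.
apply: co_inj => p; rewrite co_vec mxE st_sum co_sum.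
by apply: eq_bigr => i _; rewrite !mxE stZ coZ mulrC.
Qed.

Lemma vec_unit : vec eta = 1.
Proof. exact: vec_col. Qed.

Lemma psi_vec (x : 'cV[C]_n) : psi X x = tau (vec x).
Proof.
rewrite /psi mxE tau_sum; apply: eq_bigr => i _.
by rewrite !mxE tauZ conj_co st1 mul1r mulrC.
Qed.

Lemma tau_vec (x y : 'cV[C]_n) : tau (st (vec x) * vec y) = (adj x *m y) 0 0.
Proof.
rewrite -parseval mxE; apply: eq_bigr => i _.
by rewrite -conj_co !co_vec !mxE.
Qed.

Lemma frame_star_alg : is_star_alg (fd_ops X).
Proof.
rewrite /is_star_alg /=; do !split.
- exact: addrA.
- exact: addrC.
- exact: add0r.
- by move=> x; rewrite scaleN1r subrr.
- exact: scale1r.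
- exact: scalerA.
- exact: scalerDr.
- by move=> a b x; rewrite scalerDl.
- by move=> x y z; apply: vec_inj; rewrite !vec_mul mulrA.
- by move=> x; apply: vec_inj; rewrite vec_mul vec_unit mul1r.
- by move=> x; apply: vec_inj; rewrite vec_mul vec_unit mulr1.
- by move=> x y z; apply: vec_inj;
    rewrite [LHS]vec_mul vecD mulrDl -!vec_mul -vecD.
- by move=> x y z; apply: vec_inj;
    rewrite [LHS]vec_mul vecD mulrDr -!vec_mul -vecD.
- by move=> a x y; apply: vec_inj;
    rewrite [LHS]vec_mul vecZ -scalerAl -vec_mul -vecZ.
- by move=> a x y; apply: vec_inj;
    rewrite [LHS]vec_mul vecZ -scalerAr -vec_mul -vecZ.
- by move=> x; apply: vec_inj; rewrite !vec_star stK.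
- by move=> x y; apply: vec_inj; rewrite [RHS]vecD !vec_star vecD stD.
- by move=> a x; apply: vec_inj; rewrite [RHS]vecZ !vec_star vecZ stZ.
- by move=> x y; apply: vec_inj; rewrite vec_mul !vec_star vec_mul stM.
Qed.

Lemma sc_conj p q r : Num.conj (sc p q r) = tau (st (e r) * st (e q) * e p).
Proof. by rewrite conj_co stM. Qed.

(** m m^* sends e_q to the sum of e_i st(e_i) e_q: Parseval absorbs the second tensor leg and
    [sum_ee] the first. *)
Lemma mu_coisometry : m *m adj m = 1%:M.
Proof.
apply/matrixP => p q; rewrite !mxE sum_mxvec.
transitivity (\sum_i tau (st (e p) * e i * (st (e i) * e q))).
  apply: eq_bigr => i _; rewrite -parseval; apply: eq_bigr => j _.
  by rewrite frame_muE !mxE unpair_idxE /= sc_conj /sc /co !mulrA.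
under eq_bigr => i _ do rewrite mulrA -(mulrA (st (e p))).
by rewrite -tau_sum -mulr_suml -mulr_sumr sum_ee mulr1 tau_onb.
Qed.

Lemma eta_neq0 : eta != 0.
Proof.
apply/eqP => H; have := vec_unit; rewrite H vec0 => /eqP.
by rewrite eq_sym oner_eq0.
Qed.

Lemma frame_qset : is_qset X.
Proof.
split; [exact: frame_star_alg | exact: eta_neq0 | | | exact: mu_coisometry].
- by move=> x y; rewrite psi_vec vec_mul vec_star tau_vec.
- by move=> x y; rewrite 2!(psi_vec, vec_mul) tauC -vec_mul -psi_vec.
Qed.

Lemma schurE (A B : 'M[C]_n) p q : schur X A B p q =
  \sum_i \sum_j \sum_k \sum_l
    sc p i j * (A i k * B j l) * Num.conj (sc q k l).
Proof.
rewrite /schur mxE sum_mxvec.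
under eq_bigr => k _ do under eq_bigr => l _ do
  rewrite mxE sum_mxvec mulr_suml.
under eq_bigr => k _ do under eq_bigr => l _ do
  under eq_bigr => i _ do rewrite mulr_suml.
under eq_bigr do (rewrite exchange_big; under eq_bigr do rewrite exchange_big).
rewrite exchange_big /=; apply: eq_bigr => i _.
rewrite [LHS](eq_bigr (fun k => \sum_j \sum_l
  sc p i j * (A i k * B j l) * Num.conj (sc q k l))) => [|k _].
  by rewrite exchange_big.
apply: eq_bigr => j _; apply: eq_bigr => l _.
by rewrite frame_muE kronE !mxE unpair_idxE.
Qed.

End FrameTheory.
Arguments frame_alg {R n} F.

(** * Orthonormal bases and the trace of the regular representation *)

Lemma hermitian_spectral (R : realType) n (A : 'M[R[i]]_n) : A = adj A ->
  exists P : 'M[R[i]]_n, exists l : 'rV[R[i]]_n,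
    [/\ P *m adj P = 1%:M, adj P *m P = 1%:M & A = adj P *m diag_mx l *m P].
Proof.
move=> hA; set P := spectralmx A.
have PP : P *m adj P = 1%:M.
  by rewrite /adj map_trmx; apply/unitarymxP; exact: spectral_unitarymx.
exists P, (spectral_diag A); split=> //; first exact: mulmx1C.
have nA : A \is normalmx by apply/normalmxP; rewrite -map_trmx -/(adj A) -hA.
have <- : invmx P = adj P.
  by rewrite invmx_unitary ?spectral_unitarymx // -map_trmx.
exact: (orthomx_spectralP nA).
Qed.

Section OrthonormalBasis.
Variables (R : realType) (H : starAlg R).
Local Notation C := R[i].
Variable h : H -> C.
Hypothesis hlin : scalar h.
Hypothesis hpos : forall x : H, x != 0 -> 0 < h (st x * x).

Let hD x y : h (x + y) = h x + h y.
Proof. by rewrite -[x in LHS]scale1r hlin mul1r. Qed.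
Let h0 : h 0 = 0.
Proof. by apply: (addrI (h 0)); rewrite -hD !addr0. Qed.
Let hZ a x : h (a *: x) = a * h x.
Proof. by rewrite -[a *: x]addr0 hlin h0 addr0. Qed.
Let h_sum (I : Type) (r : seq I) (P : pred I) (G : I -> H) :
  h (\sum_(i <- r | P i) G i) = \sum_(i <- r | P i) h (G i).
Proof. by apply: (big_morph h hD h0). Qed.

Lemma positive_real x : Num.conj (h (st x * x)) = h (st x * x).
Proof.
have [->|x0] := eqVneq x 0; first by rewrite mulr0 h0 conjC0.
by apply/CrealP/ger0_real/ltW/hpos.
Qed.

(** Polarisation: h (st z * z) is real for z = x + y and for z = x + i y, and the two resulting
    equations determine [h (st y * x)]. *)
Lemma positive_hermitian x y : h (st y * x) = Num.conj (h (st x * y)).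
Proof.
have E z : Num.conj (h (st x * z)) + Num.conj (h (st z * x))
          = h (st x * z) + h (st z * x).
  have := positive_real (x + z).
  rewrite stD !mulrDl !mulrDr !hD !rmorphD /= !positive_real.
  by rewrite -!addrA => /addrI; rewrite !addrA => /addIr.
have := E ('i *: y); have := E y.
rewrite stZ -!scalerAl -!scalerAr !hZ !rmorphM /= conjCi !rmorphN /= conjCi
  opprK.
set a := h (st x * y); set b := h (st y * x) => e1 e2.
have {}e2 : - Num.conj a + Num.conj b = a - b.
  by apply: (mulfI (neq0Ci C)); rewrite !mulrDr !mulrN -!mulNr.
apply: (mulfI (_ : 2 != 0 :> C)); first by rewrite pnatr_eq0.
rewrite !mulr_natl !mulr2n.
have -> : b + b = (a + b) - (a - b) by ring.
by rewrite -e1 -e2; ring.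
Qed.

Variables (d : nat) (b : 'I_d -> H) (c : 'I_d -> H -> C).
Hypothesis b_exp : forall x, x = \sum_i c i x *: b i.
Hypothesis b_free : forall s : 'I_d -> C, \sum_i s i *: b i =
  0 -> forall i, s i = 0.

(** The Gram matrix has positive eigenvalues, and rescaling its eigenvectors by their inverse square
    roots turns it into the identity. The expansion formula holds because a left inverse of a square
    matrix is a right inverse. *)
Lemma orthonormal_basis : exists e : 'I_d -> H,
  (forall i j, h (st (e i) * e j) = (i == j)%:R) /\
  (forall x, x = \sum_i h (st (e i) * x) *: e i).
Proof.
pose G := \matrix_(i, j) h (st (b i) * b j).
have hG : G = adj G.
  by apply/matrixP => i j; rewrite !mxE positive_hermitian.
have [P [l [PP PP' GE]]] := hermitian_spectral hG.
pose comb (S : 'M[C]_d) j := \sum_i S i j *: b i.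
have combE (S T : 'M[C]_d) i j : h (st (comb S i) * comb T j)
    = (adj S *m G *m T) i j.
  rewrite /comb mulr_sumr h_sum mxE; apply: eq_bigr => l' _.
  rewrite -scalerAr hZ st_sum mulr_suml h_sum mxE mulrC mulr_suml.
  by rewrite mulr_suml; apply: eq_bigr => k _; rewrite stZ -scalerAl hZ !mxE.
(* Eigenvalue i is the value of h at st y * y, where y has as coefficients column i of [adj P]; y is
   nonzero because this column has norm one. *)
have lpos i : 0 < l 0 i.
  have : 0 < h (st (comb (adj P) i) * comb (adj P) i).
    apply: hpos; apply/eqP => /b_free H0.
    have /matrixP/(_ i i) := PP; rewrite !mxE eqxx big1 => [|k _]; last first.
      by rewrite H0 mulr0.
    by move/eqP; rewrite eq_sym oner_eq0.
  rewrite combE GE adj_mxK !mulmxA PP mul1mx -mulmxA PP mulmx1 !mxE eqxx.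
  by rewrite mulr1n.
pose r := \row_i (sqrtC (l 0 i))^-1.
have rr i : r 0 i * l 0 i * r 0 i = 1.
  rewrite !mxE -{2}[l 0 i]sqrtCK expr2 mulrA mulVf ?mul1r ?mulfV //.
    by rewrite sqrtC_eq0 gt_eqF.
  by rewrite sqrtC_eq0 gt_eqF.
have radj : adj (diag_mx r) = diag_mx r.
  apply/matrixP => i j; rewrite !mxE eq_sym; case: eqVneq => [->|_]; last first.
    by rewrite !mulr0n conjC0.
  by rewrite !mulr1n fmorphV /= geC0_conj // sqrtC_ge0 ltW.
pose S := adj P *m diag_mx r.
have SG : adj S *m G *m S = 1%:M.
  rewrite /S adj_mulmx adj_mxK radj GE !mulmxA -(mulmxA (diag_mx r) P) PP
    mulmx1.
  rewrite -(mulmxA _ P) PP mulmx1 !mulmx_diag -diag_const_mx; congr diag_mx.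
  by apply/rowP => i; rewrite mxE [X in X * _]mxE rr mxE.
exists (comb S); split=> [i j|x]; first by rewrite combE SG mxE.
have SSG : S *m (adj S *m G) = 1%:M by apply: mulmx1C.
have key x' : h (st (comb S x') * x) = (adj S *m G *m \col_i c i x) x' 0.
  rewrite {1}(b_exp x) /comb mulr_sumr h_sum mxE; apply: eq_bigr => l' _.
  rewrite -scalerAr hZ st_sum mulr_suml h_sum mxE mulrC mxE; congr (_ * _).
  by apply: eq_bigr => k _; rewrite stZ -scalerAl hZ !mxE.
under eq_bigr => i _ do rewrite key scaler_sumr.
rewrite exchange_big {1}(b_exp x); apply: eq_bigr => k _ /=.
under eq_bigr do rewrite scalerA.
rewrite -scaler_suml; congr (_ *: _).
have /matrixP/(_ k 0) : S *m (adj S *m G *m \col_i c i x) = \col_i c i x.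
  by rewrite mulmxA SSG mul1mx.
by rewrite !mxE => {1}<-; apply: eq_bigr => i _; rewrite mulrC.
Qed.

End OrthonormalBasis.

(* The trace of the left regular representation; the given positive functional
   only serves to compute it in an orthonormal basis. *)
Lemma trace_frame (R : realType) (H : starAlg R) (h : H -> R[i]) d
    (b : 'I_d -> H) (c : 'I_d -> H -> R[i]) :
  scalar h -> (forall x : H, x != 0 -> 0 < h (st x * x)) ->
  (forall x, x = \sum_i c i x *: b i) ->
  (forall s : 'I_d -> R[i], \sum_i s i *: b i = 0 -> forall i, s i = 0) ->
  exists (t : H -> R[i]) (e : 'I_d -> H),
    [/\ scalar t, forall x y, t (x * y) = t (y * x),
        forall x, t (st x) = Num.conj (t x)
      & [/\ forall i j, t (st (e i) * e j) = (i == j)%:R,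
            forall x, x = \sum_i t (st (e i) * x) *: e i
          & forall x, \sum_i t (st (e i) * x * e i) = t x]].
Proof.
move=> hlin hpos b_exp b_free.
have [f [_ f_exp]] := orthonormal_basis hlin hpos b_exp b_free.
have hD x y : h (x + y) = h x + h y by rewrite -[x in LHS]scale1r hlin mul1r.
have h0 : h 0 = 0 by apply: (addrI (h 0)); rewrite -hD !addr0.
have hZ a x : h (a *: x) = a * h x by rewrite -[a *: x]addr0 hlin h0 addr0.
have h_sum (I : Type) (r : seq I) (P : pred I) (G : I -> H) :
  h (\sum_(i <- r | P i) G i) = \sum_(i <- r | P i) h (G i).
  by apply: (big_morph h hD h0).
(* The trace of left multiplication by x, computed in the basis f, which is orthonormal for h. *)
pose t x := \sum_i h (st (f i) * x * f i).
have tlin : scalar t.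
  move=> a x y; rewrite /t mulr_sumr -big_split; apply: eq_bigr => i _ /=.
  by rewrite mulrDr mulrDl -scalerAr -scalerAl hlin.
have t_pos x : x != 0 -> 0 < t (st x * x).
  move=> x0; have E i : st (f i) * (st x * x) * f i = st (x * f i) * (x * f i).
    by rewrite stM !mulrA.
  have ge0 i : 0 <= h (st (f i) * (st x * x) * f i).
    rewrite E; have [->|/hpos/ltW//] := eqVneq (x * f i) 0.
    by rewrite mulr0 h0.
  rewrite lt_def sumr_ge0 ?andbT => [|i _]; last exact: ge0.
  apply/eqP => /eqP; rewrite psumr_eq0 => [/allP H0|i _]; last exact: ge0.
  case/eqP: x0; rewrite -[x]mulr1 (f_exp 1) mulr_sumr big1 // => i _.
  rewrite -scalerAr; have := H0 i (mem_index_enum i); rewrite E /=.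
  have [->|/hpos] := eqVneq (x * f i) 0; first by rewrite scaler0.
  by rewrite lt_def => /andP[/negbTE-> _].
have [e [e_onb e_exp]] := orthonormal_basis tlin t_pos b_exp b_free.
(* Inserting the expansion along f writes t (x * y) as a double sum of products of matrix
   coefficients, which is symmetric in x and y. *)
have hf x y : h (x * y) = \sum_j h (x * f j) * h (st (f j) * y).
  rewrite {1}(f_exp y) mulr_sumr h_sum; apply: eq_bigr => j _.
  by rewrite -scalerAr hZ mulrC.
have tC x y : t (x * y) = t (y * x).
  have E u v : t (u * v) =
    \sum_i \sum_j h (st (f i) * u * f j) * h (st (f j) * v * f i).
    by apply: eq_bigr => i _; rewrite !mulrA -mulrA hf; apply: eq_bigr => j _;
      rewrite mulrA.
  rewrite !E exchange_big; apply: eq_bigr => i _; apply: eq_bigr => j _.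
  by rewrite mulrC.
have t_st x : t (st x) = Num.conj (t x).
  by rewrite -[x in RHS]mul1r -[1 in RHS]st1 -(positive_hermitian tlin t_pos)
    mulr1.
(* The trace does not depend on the basis: e_i is expanded along f, then x f_j is recovered from its
   expansion along e. *)
have t_trace x : \sum_i t (st (e i) * x * e i) = t x.
  transitivity (\sum_i \sum_j t (st (e i) * (x * f j)) * h (st (f j) * e i)).
    apply: eq_bigr => i _; rewrite {2}(f_exp (e i)) mulr_sumr.
    have tsum : forall (G : 'I_d -> H), t (\sum_j G j) = \sum_j t (G j).
      by move=> G; rewrite /t exchange_big; apply: eq_bigr => k _ /=;
         rewrite mulr_sumr mulr_suml h_sum.
    rewrite tsum; apply: eq_bigr => j _.
    rewrite -scalerAr -mulrA [LHS](_ : _ =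
      h (st (f j) * e i) * t (st (e i) * (x * f j))).
      by rewrite mulrC.
    rewrite /t mulr_sumr; apply: eq_bigr => k _.
    by rewrite -scalerAr -scalerAl hZ.
  rewrite exchange_big; apply: eq_bigr => j _ /=.
  rewrite -[in RHS]mulrA {2}(e_exp (x * f j)) mulr_sumr h_sum.
  by apply: eq_bigr => i _; rewrite -scalerAr hZ.
by exists t, e.
Qed.

(** * Quantum permutation matrices *)

Section QuantumPermutation.
Variables (R : realType) (n : nat) (F : frame R n) (B : starAlg R).
Local Notation C := R[i].
Local Notation X := (frame_alg F).
Local Notation m := (fd_mu X).
Local Notation eta := (fd_unit X).
Local Notation e := (@fe R n F).

Record qperm (V : 'M[B]_n) : Prop := QPerm {
  qperm_mulVadj : V *m dag V = 1%:M;
  qperm_adjmulV : dag V *m V = 1%:M;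
  qperm_mul : forall p k l, \sum_i \sum_j sc F p i j *: (V i k * V j l)
                            = \sum_q sc F q k l *: V p q;
  qperm_unit : V *m emb B eta = emb B eta }.

Variable V : 'M[B]_n.
Hypothesis hV : qperm V.

Definition intertwines (T : 'M[C]_n) := V *m emb B T = emb B T *m V.

Lemma intertwines1 : intertwines 1%:M.
Proof. by rewrite /intertwines emb1 mul1mx mulmx1. Qed.

Lemma intertwinesD S T :
  intertwines S -> intertwines T -> intertwines (S + T).
Proof.
by rewrite /intertwines /emb map_mxD mulmxDl mulmxDr => -> ->.
Qed.

Lemma intertwinesZ a T : intertwines T -> intertwines (a *: T).
Proof.
move=> /matrixP hT; apply/matrixP => i j; have := hT i j.
rewrite !mul_embE !mulE_emb => H.
under eq_bigr do rewrite mxE -scalerA.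
under [RHS]eq_bigr do rewrite mxE -scalerA.
by rewrite -!scaler_sumr H.
Qed.

Lemma intertwinesB S T :
  intertwines S -> intertwines T -> intertwines (S - T).
Proof.
by move=> hS hT; rewrite -scaleN1r; apply/intertwinesD/intertwinesZ.
Qed.

Lemma intertwines_adj T : intertwines T -> intertwines (adj T).
Proof.
rewrite /intertwines => /(congr1 (@dag _ _ _ _)); rewrite !dagM dag_emb => H.
have /(congr1 (mulmx^~ V)) : V *m (emb B (adj T) *m dag V) =
  V *m dag V *m emb B (adj T).
  by rewrite H mulmxA.
by rewrite (qperm_mulVadj hV) mul1mx -!mulmxA (qperm_adjmulV hV) mulmx1.
Qed.

Let V2 : 'M[B]_(n * n) := \matrix_(s, t)
  (V (unpair_idx s).1 (unpair_idx t).1 * V (unpair_idx s).2 (unpair_idx t).2).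

Let V2E i j k l : V2 (mxvec_index i j) (mxvec_index k l) = V i k * V j l.
Proof. by rewrite mxE !unpair_idxE. Qed.

Let V2_mul : emb B m *m V2 = V *m emb B m.
Proof.
apply/matrixP => p; case/mxvec_indexP => k l; rewrite mul_embE mulE_emb.
rewrite sum_mxvec; under [RHS]eq_bigr do rewrite frame_muE.
rewrite -(qperm_mul hV); apply: eq_bigr => i _; apply: eq_bigr => j _.
by rewrite frame_muE V2E.
Qed.

(** Entries do not commute, so the inner sum over l is evaluated first; it leaves the outer sum over
    k in the form of V times [dag V] again. *)
Let V2_dag : V2 *m dag V2 = 1%:M.
Proof.
apply/matrixP; case/mxvec_indexP => i j; case/mxvec_indexP => i' j'.
have /matrixP VV := qperm_mulVadj hV.
rewrite mxE sum_mxvec.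
transitivity (\sum_k V i k * (\sum_l V j l * dag V l j') * dag V k i').
  apply: eq_bigr => k _; rewrite mulr_sumr mulr_suml; apply: eq_bigr => l _.
  by rewrite !dagE !V2E stM !mulrA.
have := VV j j'; rewrite mxE => ->; have := VV i i';
  rewrite !mxE mxvec_index_eq.
rewrite andbC; case: (j == j') => /= H; last first.
  by rewrite big1 // => k _; rewrite mulr0 mul0r.
by rewrite -H; apply: eq_bigr => k _; rewrite !mxE mulr1.
Qed.

(** The adjoint of the relation for m, brought back from [dag V] and [dag V2] to V and V2 by
    unitarity. *)
Let V2_comul : V2 *m emb B (adj m) = emb B (adj m) *m V.
Proof.
rewrite -[LHS]mulmx1 -(qperm_adjmulV hV) mulmxA -(mulmxA V2) -dag_emb -dagM.
by rewrite -V2_mul dagM mulmxA V2_dag mul1mx.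
Qed.

Let V2_kron S T : intertwines S -> intertwines T ->
  V2 *m emb B (kron S T) = emb B (kron S T) *m V2.
Proof.
move=> /matrixP hS /matrixP hT; apply/matrixP.
case/mxvec_indexP => i j; case/mxvec_indexP => i' j'.
rewrite mulE_emb mul_embE !sum_mxvec.
transitivity ((V *m emb B S) i i' * (V *m emb B T) j j').
  rewrite !mulE_emb mulr_suml; apply: eq_bigr => k _.
  rewrite mulr_sumr; apply: eq_bigr => l _.
  by rewrite kronE V2E -scalerAl -scalerAr scalerA.
rewrite hS hT !mul_embE mulr_suml; apply: eq_bigr => k _.
rewrite mulr_sumr; apply: eq_bigr => l _.
by rewrite kronE V2E -scalerAl -scalerAr scalerA.
Qed.

(** m (S (x) T) m^* is composed of maps that intertwine V and V (x) V. *)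
Lemma intertwines_schur S T :
  intertwines S -> intertwines T -> intertwines (schur X S T).
Proof.
move=> hS hT; rewrite /intertwines /schur !embM.
by rewrite !mulmxA -V2_mul -(mulmxA _ V2) (V2_kron hS hT) mulmxA -!mulmxA
  V2_comul.
Qed.

Definition fixes (v : 'cV[C]_n) := V *m emb B v = emb B v.

Lemma fixes_mul T v : intertwines T -> fixes v -> fixes (T *m v).
Proof. by rewrite /fixes embM => hT hv; rewrite mulmxA hT -mulmxA hv. Qed.

Lemma fixesB v w : fixes v -> fixes w -> fixes (v - w).
Proof. by rewrite /fixes /emb map_mxB mulmxBr => -> ->. Qed.

Definition lmul_mx (v : 'cV[C]_n) : 'M[C]_n :=
  \matrix_(p, q) co p (vec F v * e q).

Lemma lmul_mxE v p q : lmul_mx v p q = \sum_k v k 0 * sc F p k q.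
Proof.
rewrite mxE mulr_suml co_sum; apply: eq_bigr => k _.
by rewrite -scalerAl coZ.
Qed.

(** Fixing the first factor at an invariant vector turns the multiplicativity m (V (x) V) = V m into
    commutation with left multiplication. *)
Lemma intertwines_lmul v : fixes v -> intertwines (lmul_mx v).
Proof.
move=> /matrixP hv; apply/matrixP => p l; rewrite mulE_emb mul_embE.
under eq_bigr do rewrite lmul_mxE scaler_suml.
rewrite exchange_big /=.
transitivity (\sum_k \sum_i \sum_j (v k 0 * sc F p i j) *: (V i k * V j l)).
  apply: eq_bigr => k _; under eq_bigr do rewrite -scalerA.
  rewrite -scaler_sumr -(qperm_mul hV) scaler_sumr; apply: eq_bigr => i _.
  by rewrite scaler_sumr; apply: eq_bigr => j _; rewrite scalerA.
rewrite exchange_big /=; under eq_bigr do rewrite exchange_big.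
rewrite exchange_big; apply: eq_bigr => j _; rewrite lmul_mxE scaler_suml.
apply: eq_bigr => i _ /=.
have := hv i 0; rewrite mulE_emb embE => /(congr1 (fun x =>
  sc F p i j *: (x * V j l))).
rewrite mulr_algl scalerA mulrC => <-; rewrite mulr_suml scaler_sumr.
by apply: eq_bigr => k _; rewrite -scalerAl scalerA mulrC.
Qed.

(** V preserves psi: by unitarity [dag V] also fixes eta, and the adjoint of that relation is the
    claim. *)
Lemma qperm_inv q : \sum_p tau (e p) *: V p q = (tau (e q))%:A.
Proof.
have /(congr1 (@dag _ _ _ _)) : dag V *m emb B eta = emb B eta.
  by rewrite -[in LHS](qperm_unit hV) mulmxA (qperm_adjmulV hV) mul1mx.
rewrite dagM dagK dag_emb => /matrixP/(_ 0 q); rewrite mul_embE embE.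
have E p : adj eta 0 p = tau (e p) by rewrite !mxE conj_co st1 mul1r.
by rewrite E => <-; apply: eq_bigr => p _; rewrite E.
Qed.

(** The defining relations do not say that V respects the involution. But V is multiplicative and
    preserves psi, so it preserves the bilinear form tau (x y); moving one V to the other side by
    unitarity produces the adjoint entries. *)
Lemma qperm_star j k :
  \sum_i tau (e i * e j) *: V i k = \sum_l tau (e k * e l) *: st (V j l).
Proof.
have mE i l : tau (e i * e l) = \sum_p tau (e p) * sc F p i l.
  by rewrite -[e i * e l]mul1r -parseval; apply: eq_bigr => p _; rewrite mul1r.
pose w : 'rV[B]_n := \row_j \sum_i tau (e i * e j) *: V i k.
have wV : w *m V = emb B (\row_l tau (e k * e l)).
  apply/matrixP => i0 l; rewrite !mxE.
  transitivity (\sum_p tau (e p) *: \sum_i \sum_j sc F p i j *: (V i k * V j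
    l)).
    under [RHS]eq_bigr do (rewrite scaler_sumr;
      under eq_bigr do rewrite scaler_sumr).
    under [LHS]eq_bigr do rewrite /w mxE mulr_suml.
    rewrite exchange_big [RHS]exchange_big; apply: eq_bigr => i _ /=.
    rewrite [RHS]exchange_big; apply: eq_bigr => j' _ /=.
    rewrite mE -scalerAl scaler_suml; apply: eq_bigr => p _.
    by rewrite scalerA.
  under eq_bigr do rewrite (qperm_mul hV) scaler_sumr.
  rewrite exchange_big /= mE scaler_suml; apply: eq_bigr => q _.
  under eq_bigr do rewrite scalerA mulrC -scalerA.
  by rewrite -scaler_sumr qperm_inv scalerA mulrC.
have : w = emb B (\row_l tau (e k * e l)) *m dag V.
  by rewrite -wV -mulmxA (qperm_mulVadj hV) mulmx1.
move=> /matrixP/(_ 0 j); rewrite mul_embE mxE => ->.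
by apply: eq_bigr => l _; rewrite dagE mxE.
Qed.

(** The action given by V commutes with the involution, here on basis vectors. *)
Lemma qperm_co_st j k :
  \sum_l co l (st (e k)) *: V j l = \sum_i co j (st (e i)) *: st (V i k).
Proof.
have E p q : Num.conj (tau (e p * e q)) = co q (st (e p)).
  by rewrite -tau_st stM.
have := congr1 st (qperm_star j k); rewrite !st_sum => H.
transitivity (\sum_l st (tau (e k * e l) *: st (V j l))).
  by apply: eq_bigr => l _; rewrite stZ stK E.
rewrite -H; apply: eq_bigr => i _.
by rewrite stZ E co_st co_st co_st.
Qed.

End QuantumPermutation.

(** * Invariance of the trace *)

Section DedekindFinite.
Variables (R : realType) (n : nat) (F : frame R n) (k : nat).
Local Notation C := R[i].

(** The left regular representation applied entrywise. It embeds the matrices over F into complex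
    matrices, where a one-sided inverse is two-sided. *)
Let blow (M : 'M[F]_k) : 'M[C]_(k * n) := \matrix_(s, t)
  co (unpair_idx s).2 (M (unpair_idx s).1 (unpair_idx t).1 * fe (unpair_idx
    t).2).

Let blowE M i a j b :
  blow M (mxvec_index i a) (mxvec_index j b) = co a (M i j * fe b).
Proof. by rewrite mxE !unpair_idxE. Qed.

Let blowM M N : blow (M *m N) = blow M *m blow N.
Proof.
apply/matrixP; case/mxvec_indexP => i a; case/mxvec_indexP => j b.
rewrite !mxE !unpair_idxE sum_mxvec mulr_suml co_sum; apply: eq_bigr => l _ /=.
rewrite /co -mulrA mulrA -parseval; apply: eq_bigr => c _.
by rewrite !blowE /co !mulrA.
Qed.

Let blow1 : blow 1%:M = 1%:M.
Proof.
apply/matrixP; case/mxvec_indexP => i a; case/mxvec_indexP => j b.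
rewrite blowE !mxE mxvec_index_eq; case: (i == j) => /=.
  by rewrite mul1r co_e.
by rewrite mul0r co0.
Qed.

Let blow_inj : injective blow.
Proof.
move=> M N /matrixP MN; apply/matrixP => i j.
have E b : M i j * fe b = N i j * fe b.
  by apply: co_inj => a; have := MN (mxvec_index i a) (mxvec_index j b);
    rewrite !blowE.
rewrite -[M i j]mulr1 -[N i j]mulr1 (co_exp (1 : F)) !mulr_sumr.
by apply: eq_bigr => b _; rewrite -!scalerAr E.
Qed.

Lemma frame_mulmx1C (M N : 'M[F]_k) : M *m N = 1%:M -> N *m M = 1%:M.
Proof.
move=> MN; apply: blow_inj; rewrite blowM blow1; apply: mulmx1C.
by rewrite -blowM MN blow1.
Qed.

End DedekindFinite.

Section Hopf.
Variables (R : realType) (n : nat) (F : frame R n).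
Local Notation C := R[i].
Local Notation X := (frame_alg F).
Local Notation eta := (fd_unit X).
Local Notation e := (@fe R n F).

(* (tau (x) id) Delta for the coproduct Delta (e_j) = sum_i e_i (x) u_ij *)
Definition slice_tau (u : 'M[F]_n) (x : F) : F :=
  \sum_k co k x *: \sum_i tau (e i) *: u i k.

(* The coproduct Delta (e_j) = sum_i e_i (x) u_ij of a finite quantum group.
   The last two fields are the two cancellation laws; the first one makes
   the operator x (x) y |-> Delta x (1 (x) y) of [F (x) F = F^n], whose matrix
   is [u], surjective. *)
Record hopf (u : 'M[F]_n) : Prop := Hopf {
  hopf_mul : forall p k l, \sum_i \sum_j sc F p i j *: (u i k * u j l)
                            = \sum_q sc F q k l *: u p q;
  hopf_unit : u *m emb F eta = emb F eta;
  hopf_star : forall j k,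
    \sum_i st (u i j) * u i k = slice_tau u (st (e j) * e k);
  hopf_coassoc : forall i p q,
    \sum_k co k (u p q) *: u i k = \sum_r co i (u p r) *: u r q;
  hopf_cancel1 : exists u', u *m u' = 1%:M;
  hopf_cancel2 : forall y : F, exists z : 'I_n -> F,
    forall w : F -> C, scalar w ->
      w 1 *: y = \sum_l \sum_j w (e j * z l) *: u j l }.

Variable u : 'M[F]_n.
Hypothesis hu : hopf u.

Local Notation P := (slice_tau u).

Let n_neq0 : n%:R != 0 :> C.
Proof. by rewrite -(tau1 F); exact: tau1_neq0. Qed.

Let g k : F := \sum_i tau (e i) *: u i k.

Let tau_mxtraceC (M N : 'M[F]_n) : tau (\tr (M *m N)) = tau (\tr (N *m M)).
Proof.
rewrite /mxtrace !tau_sum.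
under eq_bigr do rewrite mxE tau_sum.
under [RHS]eq_bigr do rewrite mxE tau_sum.
by rewrite exchange_big; apply: eq_bigr => i _; apply: eq_bigr => j _;
  rewrite tauC.
Qed.

Let sc_trace i : \sum_p sc F p i p = tau (e i).
Proof. by rewrite -tau_trace; apply: eq_bigr => p _; rewrite /sc /co mulrA. Qed.

(* Left multiplication by Delta (e_k) is conjugate, by the invertible
   matrix u, to left multiplication by e_k (x) 1; compare traces. *)
Lemma tau_conv_tau k : tau (g k) = n%:R * tau (e k).
Proof.
have [u' uu'] := hopf_cancel1 hu; have u'u := frame_mulmx1C uu'.
pose LL : 'M[F]_n := \matrix_(p, j) \sum_i sc F p i j *: u i k.
pose L : 'M[C]_n := \matrix_(q, l) sc F q k l.
have LLu : LL *m u = u *m emb F L.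
  apply/matrixP => p l; rewrite mulE_emb mxE.
  under [RHS]eq_bigr do rewrite mxE.
  rewrite -(hopf_mul hu) exchange_big /=; apply: eq_bigr => j _.
  by rewrite mxE mulr_suml; apply: eq_bigr => i _; rewrite scalerAl.
have -> : tau (g k) = tau (\tr LL).
  rewrite /mxtrace; under [in RHS]eq_bigr do rewrite mxE.
  rewrite exchange_big /= !tau_sum; apply: eq_bigr => i _.
  by rewrite -scaler_suml tauZ sc_trace -tauZ.
have -> : LL = u *m (emb F L *m u') by rewrite mulmxA -LLu -mulmxA uu' mulmx1.
rewrite tau_mxtraceC -mulmxA u'u mulmx1 /mxtrace tau_sum mulrC -sc_trace.
by rewrite mulr_suml; apply: eq_bigr => q _; rewrite embE mxE tauZ tau1.
Qed.

Let tau_P x : tau (P x) = n%:R * tau x.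
Proof.
rewrite /slice_tau tau_sum [in RHS](co_exp x) tau_sum mulr_sumr.
by apply: eq_bigr => k _; rewrite !tauZ tau_conv_tau mulrCA.
Qed.

Let PD x y : P (x + y) = P x + P y.
Proof.
by rewrite -big_split; apply: eq_bigr => k _; rewrite coD scalerDl.
Qed.
Let PZ a x : P (a *: x) = a *: P x.
Proof.
by rewrite scaler_sumr; apply: eq_bigr => k _; rewrite coZ scalerA.
Qed.
Let P_sum (I : Type) (r : seq I) (Q : pred I) (G : I -> F) :
  P (\sum_(i <- r | Q i) G i) = \sum_(i <- r | Q i) P (G i).
Proof.
apply: (big_morph P PD); rewrite /slice_tau big1 // => k _.
by rewrite co0 scale0r.
Qed.

Let tau_co (x : F) : \sum_i tau (e i) * co i x = tau x.
Proof.
by rewrite -[x in RHS]mul1r -parseval; apply: eq_bigr => i _; rewrite mul1r.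
Qed.

Let P_u p q : P (u p q) = \sum_r tau (u p r) *: u r q.
Proof.
rewrite /slice_tau; under eq_bigr do rewrite scaler_sumr.
rewrite exchange_big /=.
transitivity (\sum_i tau (e i) *: \sum_r co i (u p r) *: u r q).
  apply: eq_bigr => i _; rewrite -(hopf_coassoc hu) scaler_sumr.
  by apply: eq_bigr => k _; rewrite !scalerA mulrC.
under [LHS]eq_bigr do rewrite scaler_sumr.
rewrite exchange_big; apply: eq_bigr => r _ /=.
by under [LHS]eq_bigr do rewrite scalerA; rewrite -scaler_suml tau_co.
Qed.

(** For the state tau / n this is idempotence under convolution. It follows from coassociativity, in
    the form [P_u], and from [tau_conv_tau]. *)
Let PP x : P (P x) = n%:R *: P x.
Proof.
rewrite {2 3}/slice_tau P_sum scaler_sumr; apply: eq_bigr => k _.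
rewrite PZ scalerA mulrC -scalerA; congr (_ *: _).
rewrite P_sum; under eq_bigr do rewrite PZ P_u scaler_sumr.
rewrite exchange_big scaler_sumr; apply: eq_bigr => r _ /=.
under eq_bigr do rewrite scalerA.
rewrite -scaler_suml scalerA; congr (_ *: _); rewrite -tau_conv_tau /g tau_sum.
by apply: eq_bigr => i _; rewrite tauZ.
Qed.

(* A tracial faithful idempotent state is invariant: for b = P x the element
   Delta b - 1 (x) b has norm zero, and cancellation then forces b to be
   scalar. *)
Lemma haar_invariance x : P x = (tau x)%:A.
Proof.
set b := P x; have Pb : P b = n%:R *: b by exact: PP.
(* The legs of Delta b; w holds those of Delta b - 1 (x) b. *)
pose v i := \sum_j co j b *: u i j.
pose w i := v i - co i (1 : F) *: b.
have vv : \sum_i st (v i) * v i = P (st b * b).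
  transitivity (\sum_j \sum_k (Num.conj (co j b) * co k b) *:
                  \sum_i st (u i j) * u i k).
    under [RHS]eq_bigr do under eq_bigr do rewrite scaler_sumr.
    under [RHS]eq_bigr do rewrite exchange_big.
    rewrite [RHS]exchange_big; apply: eq_bigr => i _ /=.
    rewrite st_sum mulr_suml; apply: eq_bigr => j _.
    rewrite mulr_sumr; apply: eq_bigr => k _.
    by rewrite stZ -scalerAl -scalerAr scalerA.
  rewrite {3 4}(co_exp b) st_sum mulr_suml P_sum; apply: eq_bigr => j _.
  rewrite mulr_sumr P_sum; apply: eq_bigr => k _.
  by rewrite stZ -scalerAl -scalerAr scalerA PZ (hopf_star hu).
have co1 i : Num.conj (co i (1 : F)) = tau (e i) by rewrite conj_co st1 mul1r.
have v1 : \sum_i tau (e i) *: v i = n%:R *: b.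
  rewrite -Pb /v; under eq_bigr do rewrite scaler_sumr.
  rewrite exchange_big; apply: eq_bigr => j _ /=; rewrite scaler_sumr.
  by apply: eq_bigr => i _; rewrite !scalerA mulrC.
have cross : \sum_i st (co i (1 : F) *: b) * v i = n%:R *: (st b * b).
  rewrite scalerAr -v1 mulr_sumr; apply: eq_bigr => i _.
  by rewrite stZ co1 -scalerAl scalerAr.
have cross' : \sum_i st (v i) * (co i (1 : F) *: b) = n%:R *: (st b * b).
  have := congr1 st cross; rewrite st_sum stZ conjC_nat stM stK => <-.
  by apply: eq_bigr => i _; rewrite stM stK.
(* Expanding the square leaves P (st b * b) - n st b * b, which has trace zero by [tau_P]. *)
have w0 : \sum_i tau (st (w i) * w i) = 0.
  rewrite -tau_sum.
  have -> : \sum_i st (w i) * w i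
    = P (st b * b) - n%:R *: (st b * b) - n%:R *: (st b * b)
      + \sum_i st (co i (1 : F) *: b) * (co i (1 : F) *: b).
    rewrite -vv -{1}cross' -cross -!sumrB -big_split; apply: eq_bigr => i _ /=.
    rewrite /w -scaleN1r stD !stZ rmorphN rmorph1 !scaleN1r mulrBr mulrBl.
    rewrite !mulrDl !mulNr opprD opprK -!addrA; congr (_ + _).
    by rewrite addrCA.
  have -> : \sum_i st (co i (1 : F) *: b) * (co i (1 : F) *: b) =
    n%:R *: (st b * b).
    under eq_bigr do rewrite stZ -scalerAl -scalerAr scalerA co1.
    by rewrite -scaler_suml tau_co tau1.
  by rewrite subrK tauD -scaleN1r !tauZ tau_P mulN1r subrr.
have wz i : w i = 0.
  apply: tau_eq0; apply/eqP.
  have ge0 j : 0 <= tau (st (w j) * w j).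
    by rewrite tau_pos sumr_ge0 // => k _; apply: exprn_ge0.
  move/eqP: w0; rewrite psumr_eq0 => [/allP/(_ i (mem_index_enum i))//|j _].
  exact: ge0.
have [u' uu'] := hopf_cancel1 hu; have u'u := frame_mulmx1C uu'.
(* Now Delta b = 1 (x) b = Delta 1 (1 (x) b), and the inverse of u gives b (x) 1 = 1 (x) b. Applying
   [tau] to the first leg then shows that b is scalar. *)
have key : emb F (\col_j co j b) = emb F eta *m b%:M.
  rewrite -[LHS]mul1mx -u'u -mulmxA.
  have -> : u *m emb F (\col_j co j b) = emb F eta *m b%:M.
    apply/matrixP => i j; rewrite ord1 mulE_emb !mxE big_ord1 !mxE eqxx mulr1n.
    rewrite mulr_algl; have /eqP := wz i; rewrite subr_eq0 => /eqP <-.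
    by apply: eq_bigr => k _; rewrite mxE.
  by rewrite mulmxA -[in u' *m _](hopf_unit hu) mulmxA u'u mul1mx.
have bj j : (co j b)%:A = co j (1 : F) *: b :> F.
  have /matrixP/(_ j 0) := key; rewrite embE !mxE big_ord1 !mxE eqxx mulr1n.
  by rewrite mulr_algl.
have nb : n%:R *: b = (tau b)%:A.
  rewrite -(tau1 F) -tau_co scaler_suml -(tau_co b) scaler_suml.
  by apply: eq_bigr => j _; rewrite -!scalerA bj.
apply: (scalerI n_neq0); rewrite nb /b tau_P.
by rewrite scalerA.
Qed.

(** By [hopf_star] the entry (j, k) of [dag u *m u] is [slice_tau] of st e_j * e_k, and invariance
    makes it the scalar tau (st e_j * e_k). *)
Theorem hopf_qperm : qperm F u.
Proof.
have uu : dag u *m u = 1%:M.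
  apply/matrixP => j k; rewrite !mxE.
  under eq_bigr do rewrite dagE.
  rewrite (hopf_star hu) haar_invariance tau_onb.
  by case: eqVneq; rewrite ?scale1r ?scale0r.
split=> //; [exact: frame_mulmx1C | exact: hopf_mul | exact: hopf_unit].
Qed.

End Hopf.

(** * Convolution operators and the counit *)

Section Schur.
Variables (R : realType) (n : nat) (F : frame R n).
Local Notation C := R[i].
Local Notation X := (frame_alg F).
Local Notation e := (@fe R n F).

Definition op_of (f : F -> F) : 'M[C]_n := \matrix_(i, j) co i (f (e j)).

Lemma op_ofE (f : F -> F) : linear f ->
  forall i x, co i (f x) = \sum_k op_of f i k * co k x.
Proof.
move=> fl i x; rewrite (co_lift fl) co_sum; apply: eq_bigr => k _.
by rewrite coZ mxE mulrC.
Qed.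

Lemma vec_op_of (f : F -> F) : linear f ->
  forall v, vec F (op_of f *m v) = f (vec F v).
Proof.
move=> fl v; apply: co_inj => i; rewrite co_vec mxE (op_ofE fl).
by apply: eq_bigr => k _; rewrite co_vec.
Qed.

(** The reason is the formula m^* x = sum over r of x e_r (x) st e_r, which traciality gives for any
    orthonormal basis. *)
Lemma schur_op_of (f g : F -> F) : linear f -> linear g -> forall p q,
  schur X (op_of f) (op_of g) p q
  = co p (\sum_r f (e q * e r) * g (st (e r))).
Proof.
move=> fl gl p q; rewrite schurE co_sum.
transitivity (\sum_r \sum_i \sum_j \sum_k \sum_l
    sc F p i j * (op_of f i k * op_of g j l)
      * (co k (e q * e r) * co l (st (e r)))).
  rewrite [RHS]exchange_big; apply: eq_bigr => i _ /=.
  rewrite [RHS]exchange_big; apply: eq_bigr => j _ /=.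
  rewrite [RHS]exchange_big; apply: eq_bigr => k _ /=.
  rewrite [RHS]exchange_big; apply: eq_bigr => l _ /=.
  rewrite -mulr_sumr; congr (_ * _).
  rewrite sc_conj tauC mulrA.
  transitivity (\sum_r tau (st (e k) * e q * e r) * co r (st (e l))).
    by rewrite parseval tauC mulrA tauC mulrA.
  by apply: eq_bigr => r _; rewrite co_st /co mulrA.
apply: eq_bigr => r _.
rewrite (co_exp (f _)) mulr_suml co_sum; apply: eq_bigr => i _.
rewrite (co_exp (g _)) mulr_sumr co_sum; apply: eq_bigr => j _.
rewrite -scalerAl -scalerAr !coZ (op_ofE fl) (op_ofE gl) mulr_suml.
apply: eq_bigr => k _; rewrite mulr_suml mulr_sumr; apply: eq_bigr => l _.
by rewrite /sc; ring.
Qed.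

End Schur.

Section Convolution.
Variables (R : realType) (n : nat) (F : frame R n) (u : 'M[F]_n).
Local Notation C := R[i].
Local Notation X := (frame_alg F).
Local Notation e := (@fe R n F).
Hypothesis hu : hopf u.
Let qu : qperm F u := hopf_qperm hu.

(* [leg i x = (e_i^* (x) id) (Delta x)] *)
Definition leg (i : 'I_n) (x : F) : F := \sum_k co k x *: u i k.

Lemma leg_linear i : linear (leg i).
Proof.
move=> a x y; rewrite /leg scaler_sumr -big_split; apply: eq_bigr => k _.
by rewrite coD coZ scalerDl scalerA.
Qed.

Lemma leg_e i j : leg i (e j) = u i j.
Proof.
rewrite /leg (bigD1 j) //= co_e eqxx scale1r big1 ?addr0 // => k kj.
by rewrite co_e (negbTE kj) scale0r.
Qed.

Lemma legM p x y :
  leg p (x * y) = \sum_i \sum_j sc F p i j *: (leg i x * leg j y).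
Proof.
transitivity (\sum_k \sum_l (co k x * co l y) *: leg p (e k * e l)).
  rewrite {1}(co_exp x) {1}(co_exp y) mulr_suml.
  have leg0 : leg p 0 = 0 by apply: big1 => k _; rewrite co0 scale0r.
  have legD z t : leg p (z + t) = leg p z + leg p t.
    by rewrite -[z in LHS]scale1r leg_linear scale1r.
  have legZ a z : leg p (a *: z) = a *: leg p z.
    by rewrite -[a *: z]addr0 leg_linear leg0 addr0.
  rewrite (big_morph _ legD leg0); apply: eq_bigr => k _.
  rewrite mulr_sumr (big_morph _ legD leg0); apply: eq_bigr => l _.
  by rewrite -scalerAl -scalerAr !legZ scalerA.
under eq_bigr => k _ do under eq_bigr => l _ do
  (rewrite /leg -/(sc F _ k l) -(hopf_mul hu) scaler_sumr;
   under eq_bigr do rewrite scaler_sumr).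
under eq_bigr do rewrite exchange_big.
rewrite exchange_big; apply: eq_bigr => i _ /=.
under eq_bigr do rewrite exchange_big.
rewrite exchange_big; apply: eq_bigr => j _ /=.
rewrite /leg mulr_suml scaler_sumr; apply: eq_bigr => k _.
rewrite mulr_sumr scaler_sumr; apply: eq_bigr => l _.
rewrite -scalerAl -scalerAr !scalerA; congr (_ *: _); ring.
Qed.

Lemma leg_st i x : leg i (st x) = \sum_s co i (st (e s)) *: st (leg s x).
Proof.
transitivity (\sum_k Num.conj (co k x) *: leg i (st (e k))).
  rewrite {1}(co_exp x) st_sum /leg.
  under [RHS]eq_bigr do rewrite scaler_sumr.
  rewrite exchange_big; apply: eq_bigr => l _ /=.
  rewrite co_sum scaler_suml; apply: eq_bigr => k _.
  by rewrite stZ coZ scalerA.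
under eq_bigr do rewrite /leg (qperm_co_st qu) scaler_sumr.
rewrite exchange_big; apply: eq_bigr => s _ /=.
rewrite st_sum scaler_sumr; apply: eq_bigr => k _.
by rewrite stZ !scalerA mulrC.
Qed.

Definition leg_mx (i : 'I_n) : 'M[C]_n := op_of (leg i).

Lemma leg_mxE i k j : leg_mx i k j = co k (u i j).
Proof. by rewrite mxE leg_e. Qed.

(** [leg] slices the first leg of Delta, while u encodes Delta itself, so commutation is
    coassociativity. *)
Lemma intertwines_leg i : intertwines u (leg_mx i).
Proof.
apply/matrixP => p q; rewrite mulE_emb mul_embE.
under eq_bigr do rewrite leg_mxE.
under [RHS]eq_bigr do rewrite leg_mxE.
exact: (hopf_coassoc hu).
Qed.

(* [conv a x = (tau (a -) (x) id) (Delta x)] *)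
Definition conv (a x : F) : F := \sum_i tau (a * e i) *: leg i x.

Lemma conv_linear a : linear (conv a).
Proof.
move=> c x y; rewrite /conv scaler_sumr -big_split; apply: eq_bigr => i _ /=.
by rewrite leg_linear scalerDr !scalerA mulrC.
Qed.

Definition conv_mx a : 'M[C]_n := op_of (conv a).

Lemma conv_mxE a : conv_mx a = \sum_i tau (a * e i) *: leg_mx i.
Proof.
apply/matrixP => p q; rewrite !mxE summxE /conv co_sum; apply: eq_bigr => i _.
by rewrite !mxE coZ.
Qed.

Lemma conv_mx_linear : linear conv_mx.
Proof.
move=> c a b; rewrite !conv_mxE scaler_sumr -big_split;
  apply: eq_bigr => i _ /=.
by rewrite mulrDl -scalerAl tauD tauZ scalerDl scalerA.
Qed.

Lemma conv_mx_st_e k : conv_mx (st (e k)) = leg_mx k.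
Proof.
rewrite conv_mxE (bigD1 k) //= tau_onb eqxx scale1r big1 ?addr0 // => i ik.
by rewrite tau_onb eq_sym (negbTE ik) scale0r.
Qed.

Lemma intertwines_conv a : intertwines u (conv_mx a).
Proof.
rewrite conv_mxE; elim/big_ind: _ => [|S T|i _].
- by rewrite /intertwines /emb map_mx0 mulmx0 mul0mx.
- exact: intertwinesD.
- exact/intertwinesZ/intertwines_leg.
Qed.

Lemma conv_mul a x y :
  conv a (x * y) = \sum_i \sum_j tau (a * e i * e j) *: (leg i x * leg j y).
Proof.
rewrite /conv; under eq_bigr do rewrite legM scaler_sumr.
rewrite exchange_big; apply: eq_bigr => i _ /=.
under eq_bigr do rewrite scaler_sumr.
rewrite exchange_big; apply: eq_bigr => j _ /=.
under eq_bigr do rewrite scalerA.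
by rewrite -scaler_suml parseval mulrA.
Qed.

Lemma conv_st a x :
  conv a (st x) = \sum_s tau (a * st (e s)) *: st (leg s x).
Proof.
rewrite /conv; under eq_bigr do rewrite leg_st scaler_sumr.
rewrite exchange_big; apply: eq_bigr => s _ /=.
under eq_bigr do rewrite scalerA.
by rewrite -scaler_suml parseval.
Qed.

Lemma st_conv_st a x : st (conv a (st x)) = conv (st a) x.
Proof.
rewrite conv_st st_sum; apply: eq_bigr => s _.
by rewrite stZ stK -tau_st stM stK tauC.
Qed.

(** In the sum over r from [schur_op_of], the legs of e_r and st e_r are entries of u and their
    adjoints, and unitarity of u collapses that sum. What remains is tau (a e_i b) = tau (b a e_i),
    which explains the order of the product. *)
Lemma schur_conv a b : schur X (conv_mx a) (conv_mx b) = conv_mx (b * a).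
Proof.
apply/matrixP => p q; rewrite (schur_op_of (conv_linear a) (conv_linear b)).
rewrite [RHS]mxE; congr (co p _).
under eq_bigr do (rewrite conv_mul mulr_suml;
  under eq_bigr do rewrite mulr_suml).
rewrite exchange_big; apply: eq_bigr => i _ /=.
rewrite exchange_big /=.
transitivity (\sum_j (tau (a * e i * e j) * co j b) *: leg i (e q)); last first.
  by rewrite -scaler_suml parseval tauC mulrA.
apply: eq_bigr => j _; rewrite -scalerA.
under eq_bigr do rewrite -scalerAl -(mulrA (leg _ _)).
rewrite -scaler_sumr -mulr_sumr; congr (_ *: _).
transitivity (leg i (e q) * (co j b)%:A); last by rewrite mulr_algr.
congr (_ * _).
under eq_bigr do rewrite leg_e conv_st mulr_sumr.
rewrite exchange_big /=.
transitivity (\sum_s tau (b * st (e s)) *: (j == s)%:R : F).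
  apply: eq_bigr => s _; have /matrixP/(_ j s) := qperm_mulVadj qu.
  rewrite !mxE => <-; rewrite scaler_sumr; apply: eq_bigr => r _.
  by rewrite leg_e dagE scalerAr.
rewrite (bigD1 j) //= eqxx big1 ?addr0 => [|s sj]; last first.
  by rewrite eq_sym (negbTE sj) scaler0.
by rewrite tauC.
Qed.

(** The second cancellation law, sliced by [tau] and divided by tau 1. *)
Lemma u_span (y : F) :
  exists z : 'I_n -> F, y = \sum_l \sum_j tau (e j * z l) *: u j l.
Proof.
have [z Hz] := hopf_cancel2 hu y; exists (fun l => (tau (1 : F))^-1 *: z l).
have := Hz _ (@tau_scalar _ _ F) => /(congr1 ( *:%R (tau (1 : F))^-1)).
rewrite scalerA mulVf ?tau1_neq0 // scale1r => ->; rewrite scaler_sumr.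
apply: eq_bigr => l _; rewrite scaler_sumr; apply: eq_bigr => j _.
by rewrite -scalerAr tauZ scalerA.
Qed.

Lemma hopf_ind (Q : F -> Prop) : (forall x y, Q x -> Q y -> Q (x + y)) ->
  (forall a x, Q x -> Q (a *: x)) -> (forall i j, Q (u i j)) -> forall x, Q x.
Proof.
move=> QD QZ Qu x; have [z ->] := u_span x.
(* 0 is obtained as a multiple of an entry of u, which requires an index; n = 0 is excluded because
   tau 1 = n is nonzero. *)
have Q0 : Q 0.
  case: (posnP n) => [n0|n_gt0].
    by have /negP[] := tau1_neq0 F; rewrite tau1 -[_ == _]/((n%:R : C) == 0) n0.
  rewrite -(scale0r (u (Ordinal n_gt0) (Ordinal n_gt0))).
  exact/QZ/Qu.
elim/big_ind: _ => [//||l _]; first exact: QD.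
elim/big_ind: _ => [//||j _]; first exact: QD.
exact/QZ/Qu.
Qed.

(* Van Daele's construction of the counit from the inverse of
   x (x) y |-> Delta x (1 (x) y). *)
Lemma counit_exists : exists eps : F -> C,
  scalar eps /\ forall p q, eps (u p q) = (p == q)%:R.
Proof.
(* The two legs of [dag u] applied to x (x) 1 are multiplied together. In Hopf algebra notation this
   is x_(1) S (x_(2)), that is eps x times 1; the normalised trace later reads off the scalar. *)
pose E (x : F) := \sum_k co k x *: \sum_i e i * st (u k i).
have EE p q : E (u p q) = (p == q)%:R.
  have comm : dag u *m emb F (leg_mx p) = emb F (leg_mx p) *m dag u.
    rewrite -[LHS]mulmx1 -(qperm_mulVadj qu) mulmxA -(mulmxA (dag u)).
    by rewrite -(intertwines_leg p) mulmxA (qperm_adjmulV qu) mul1mx.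
  transitivity (\sum_i e i * (dag u *m emb F (leg_mx p)) i q).
    rewrite /E; under eq_bigr do rewrite scaler_sumr.
    rewrite exchange_big; apply: eq_bigr => i _ /=.
    rewrite mulE_emb mulr_sumr; apply: eq_bigr => k _.
    by rewrite dagE leg_mxE scalerAr.
  rewrite comm.
  transitivity (\sum_r u p r * dag u r q).
    under eq_bigr do rewrite mul_embE mulr_sumr.
    rewrite exchange_big; apply: eq_bigr => r _ /=.
    rewrite (co_exp (u p r)) mulr_suml; apply: eq_bigr => i _.
    by rewrite leg_mxE -scalerAr scalerAl.
  by have /matrixP/(_ p q) := qperm_mulVadj qu; rewrite !mxE.
exists (fun x => (tau (1 : F))^-1 * tau (E x)); split=> [a x y|p q].
  have -> : E (a *: x + y) = a *: E x + E y.
    rewrite /E scaler_sumr -big_split; apply: eq_bigr => k _ /=.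
    by rewrite coD coZ scalerDl scalerA.
  by rewrite tauD tauZ mulrDr mulrCA.
rewrite EE; case: (p == q); first by rewrite mulVf ?tau1_neq0.
have t0 : tau (0 : F) = 0 by rewrite -(scale0r (1 : F)) tauZ mul0r.
by rewrite t0 mulr0.
Qed.

End Convolution.

(** * Factorisation of a commuting quantum permutation through C(G) *)

Section Universal.
Variables (R : realType) (n : nat) (F : frame R n) (u : 'M[F]_n).
Local Notation C := R[i].
Local Notation e := (@fe R n F).
Hypothesis hu : hopf u.
Let qu : qperm F u := hopf_qperm hu.
Variables (B : starAlg R) (V : 'M[B]_n).
Hypothesis qV : qperm F V.
Hypothesis V_leg : forall p, intertwines V (leg_mx u p).

(* (eps (x) id) alpha for alpha (e_k) = sum_m e_m (x) V_mk *)
Lemma qperm_factor_linear : exists pi : F -> B,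
  linear pi /\ forall i j, pi (u i j) = V i j.
Proof.
have [eps [eps_lin eps_u]] := counit_exists hu.
exists (fun x => \sum_k co k x *: \sum_m eps (e m) *: V m k);
  split=> [a x y|i j].
  rewrite scaler_sumr -big_split; apply: eq_bigr => k _ /=.
  by rewrite coD coZ scalerDl scalerA.
under eq_bigr do rewrite scaler_sumr.
rewrite exchange_big /=.
(* Since u_ij = leg i e_j and the action alpha commutes with leg i, the counit only has to be
   evaluated on the entries u_il. *)
transitivity (\sum_m eps (e m) *: \sum_l co m (u i l) *: V l j).
  apply: eq_bigr => m _.
  have <- : \sum_k co k (u i j) *: V m k = \sum_l co m (u i l) *: V l j.
    have /matrixP/(_ m j) := V_leg i; rewrite mulE_emb mul_embE => H.
    transitivity (\sum_k leg_mx u i k j *: V m k).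
      by apply: eq_bigr => k _; rewrite leg_mxE.
    by rewrite H; apply: eq_bigr => l _; rewrite leg_mxE.
  rewrite scaler_sumr; apply: eq_bigr => k _.
  by rewrite !scalerA mulrC.
under eq_bigr do rewrite scaler_sumr.
rewrite exchange_big /=.
transitivity (\sum_l eps (u i l) *: V l j).
  apply: eq_bigr => l _.
  have -> := co_lift (U := C^o) eps_lin (u i l).
  rewrite scaler_suml; apply: eq_bigr => m _.
  by rewrite scalerA mulrC.
rewrite (bigD1 i) //= eps_u eqxx scale1r big1 ?addr0 // => l li.
by rewrite eps_u eq_sym (negbTE li) scale0r.
Qed.

(** The defect N of multiplicativity is bilinear. The relations for u and V kill only combinations
    of N (u_ik) (u_jl) weighted by structure constants; the second cancellation law isolates a
    single entry. *)
Lemma qperm_factor : exists pi : F -> B,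
  [/\ linear pi, {morph pi : x y / x * y}, {morph pi : x / st x >-> st x},
      pi 1 = 1 & forall i j, pi (u i j) = V i j].
Proof.
have [pi [pi_lin pi_u]] := qperm_factor_linear.
have pi0 : pi 0 = 0.
  by have := pi_lin (-1) 0 0; rewrite !scaleN1r !addNr.
have piD x y : pi (x + y) = pi x + pi y.
  by rewrite -[x in LHS]scale1r pi_lin scale1r.
have piZ a x : pi (a *: x) = a *: pi x.
  by rewrite -[a *: x]addr0 pi_lin pi0 addr0.
have pi_sum (G : 'I_n -> F) : pi (\sum_i G i) = \sum_i pi (G i).
  exact: (big_morph pi piD pi0).
pose N x y := pi (x * y) - pi x * pi y.
have N_sumr (G : 'I_n -> F) x : N x (\sum_i G i) = \sum_i N x (G i).
  by rewrite /N mulr_sumr !pi_sum mulr_sumr -sumrB.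
have NZl a x y : N (a *: x) y = a *: N x y.
  by rewrite /N -scalerAl !piZ -scalerAl scalerBr.
have NZr a x y : N x (a *: y) = a *: N x y.
  by rewrite /N -scalerAr !piZ -scalerAr scalerBr.
have N_uu (w : F -> C) k l : scalar w ->
    \sum_i \sum_j w (e i * e j) *: N (u i k) (u j l) = 0.
  move=> wl.
  have wE i j : w (e i * e j) = \sum_p w (e p) * sc F p i j.
    rewrite [LHS](co_lift (U := C^o) wl); apply: eq_bigr => p _.
    by rewrite [LHS]mulrC.
  have rel (A : lmodType C) (f : 'I_n -> 'I_n -> A) (t : 'I_n -> A) :
      (forall p, \sum_i \sum_j sc F p i j *: f i j = t p) ->
      \sum_i \sum_j w (e i * e j) *: f i j = \sum_p w (e p) *: t p.
    move=> ft; under [RHS]eq_bigr do rewrite -ft scaler_sumr.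
    rewrite [RHS]exchange_big; apply: eq_bigr => i _ /=.
    under [RHS]eq_bigr do rewrite scaler_sumr.
    rewrite [RHS]exchange_big; apply: eq_bigr => j _ /=.
    by rewrite wE scaler_suml; apply: eq_bigr => p _; rewrite scalerA.
  rewrite (rel _ _ (fun p => 0)) => [|p]; first by rewrite big1 // => p _;
    rewrite scaler0.
  transitivity (pi (\sum_i \sum_j sc F p i j *: (u i k * u j l))
                - \sum_i \sum_j sc F p i j *: (V i k * V j l)).
    rewrite pi_sum -sumrB; apply: eq_bigr => i _.
    rewrite pi_sum -sumrB; apply: eq_bigr => j _.
    by rewrite piZ -scalerBr /N !pi_u.
  rewrite (hopf_mul hu) (qperm_mul qV) pi_sum -sumrB big1 // => q _.
  by rewrite piZ pi_u subrr.
have N_u p k y : N (u p k) y = 0.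
  have [z Hz] := hopf_cancel2 hu y.
  have wl i : scalar (fun x => co p (e i * x)).
    by move=> a x t; rewrite mulrDr -scalerAr coD coZ.
  (* The inserted coefficient is a Kronecker delta. The cancellation law for the functional x |-> co
     p (e_i x) now writes each scaled y as a combination of the u_jl with weights co p (e_i e_j
     z_l), to which [N_uu] applies. *)
  transitivity (\sum_i N (u i k) (co p (e i * 1) *: y)).
    rewrite (bigD1 p) //= mulr1 co_e eqxx scale1r big1 ?addr0 // => i ip.
    by rewrite mulr1 co_e eq_sym (negbTE ip) NZr scale0r.
  under eq_bigr => i _ do rewrite (Hz _ (wl i)) N_sumr.
  rewrite exchange_big big1 // => l _ /=.
  have wzl : scalar (fun x => co p (x * z l)).
    by move=> a x t; rewrite mulrDl -scalerAl coD coZ.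
  rewrite -[RHS](N_uu _ k l wzl); apply: eq_bigr => i _; rewrite N_sumr.
  by apply: eq_bigr => j _; rewrite NZr mulrA.
exists pi; split=> //.
- move=> x y; apply/eqP; rewrite -subr_eq0; apply/eqP; rewrite -/(N x y).
  move: x; apply: (hopf_ind hu) => [x1 x2 H1 H2|a x1 H1|i j]; last exact: N_u.
    by rewrite /N mulrDl !piD mulrDl opprD addrACA -/(N _ _) -/(N _ _) H1 H2
      addr0.
  by rewrite NZl H1 scaler0.
- apply: (hopf_ind hu) => [x y Hx Hy|a x Hx|m k].
  + by rewrite stD !piD Hx Hy stD.
  + by rewrite stZ !piZ Hx stZ.
  (* The vector of defects is annihilated by the matrix of the involution, which is invertible
     because the involution is antiunitary. *)
  pose a i := pi (st (u i k)) - st (V i k).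
  have Ha j : \sum_i co j (st (e i)) *: a i = 0.
    transitivity (pi (\sum_i co j (st (e i)) *: st (u i k))
                  - \sum_i co j (st (e i)) *: st (V i k)).
      by rewrite pi_sum -sumrB; apply: eq_bigr => i _; rewrite piZ scalerBr.
    rewrite -(qperm_co_st qu) -(qperm_co_st qV) pi_sum -sumrB big1 // => l _.
    by rewrite piZ pi_u subrr.
  have : \sum_j Num.conj (co j (st (e m))) *: \sum_i co j (st (e i)) *: a i = 0.
    by rewrite big1 // => j _; rewrite Ha scaler0.
  under eq_bigr do rewrite scaler_sumr.
  rewrite exchange_big /=.
  under eq_bigr => i _ do under eq_bigr do rewrite scalerA conj_co stK.
  under eq_bigr do rewrite -scaler_suml parseval tauC tau_onb.
  rewrite (bigD1 m) //= eqxx scale1r big1 ?addr0 => [/eqP|i im]; last first.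
    by rewrite (negbTE im) scale0r.
  by rewrite /a subr_eq0 pi_u => /eqP.
(* The unit relation determines pi 1 only up to division by a coordinate of 1, so a nonzero
   coordinate is chosen. *)
- have [i etai] : exists i, co i (1 : F) != 0.
    apply/existsP; apply: contraT; rewrite negb_exists => /forallP H.
    have /eqP : (1 : F) = 0.
      by apply: co_inj => i; rewrite co0; apply/eqP; rewrite -[_ == _]negbK.
    by rewrite oner_eq0.
  apply: (scalerI etai); rewrite -piZ.
  have E (A : starAlg R) (W : 'M[A]_n) : W *m emb A (fd_unit (frame_alg F))
      = emb A (fd_unit (frame_alg F)) ->
      \sum_j co j (1 : F) *: W i j = co i (1 : F) *: 1.
    move=> /matrixP/(_ i 0); rewrite mulE_emb embE mxE => <-.
    by apply: eq_bigr => j _; rewrite mxE.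
  rewrite -(E _ _ (hopf_unit hu)) pi_sum -(E _ _ (qperm_unit qV)).
  by apply: eq_bigr => j _; rewrite piZ pi_u.
Qed.

End Universal.

(** * Spectral projections *)

Section Projections.
Variables (R : realType) (n : nat) (F : frame R n).
Local Notation C := R[i].
Local Notation e := (@fe R n F).

Definition coords (x : F) : 'cV[C]_n := \col_i co i x.

Lemma vec_coords x : vec F (coords x) = x.
Proof. exact: vec_col. Qed.

Lemma mulr_e_inj (x y : F) : (forall k, x * e k = y * e k) -> x = y.
Proof.
move=> H; rewrite -[x]mulr1 -[y]mulr1 (co_exp (1 : F)) !mulr_sumr.
by apply: eq_bigr => k _; rewrite -!scalerAr H.
Qed.

(* The spectral projections of x commute with right multiplications because x
   does, hence are left multiplications by elements of the algebra. *)
Lemma selfadjoint_projections (x : F) : st x = x ->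
  exists (c : 'I_n -> C) (p : 'I_n -> F),
    (forall i, p i * p i = p i /\ st (p i) = p i) /\ x = \sum_i c i *: p i.
Proof.
move=> xx.
have mull_lin (z : F) : linear (fun y => z * y).
  by move=> a s t; rewrite mulrDr scalerAr.
have mulr_lin (z : F) : linear (fun y => y * z).
  by move=> a s t; rewrite mulrDl scalerAl.
pose M := op_of (fun y : F => x * y).
have hM : M = adj M.
  apply/matrixP => i j; rewrite !mxE conj_co stM xx -/(co _ _).
  by rewrite /co mulrA.
have [P [l [PP PP' ME]]] := hermitian_spectral hM.
(* D i selects the whole eigenspace of l_i and not a single eigenvector, so that E i commutes with
   everything that commutes with M. *)
pose D i := diag_mx (\row_k (l 0 k == l 0 i)%:R : 'rV[C]_n).
pose E i := adj P *m D i *m P.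
have DD i : D i *m D i = D i.
  rewrite mulmx_diag; congr diag_mx; apply/rowP => k; rewrite !mxE.
  by case: (_ == _); rewrite ?mulr1 ?mulr0.
have EE i : E i *m E i = E i.
  by rewrite /E !mulmxA -(mulmxA (adj P *m D i)) PP mulmx1 -(mulmxA (adj P)) DD.
have hE i : adj (E i) = E i.
  rewrite /E !adj_mulmx adj_mxK mulmxA; congr (_ *m _ *m _).
  apply/matrixP => j k; rewrite !mxE [k == j]eq_sym; have [->|_] := eqVneq j k.
    by rewrite !mulr1n conjC_nat.
  by rewrite !mulr0n conjC0.
have commE (T : 'M[C]_n) i : T *m M = M *m T -> T *m E i = E i *m T.
  move=> TM; pose T' := P *m T *m adj P.
  have T'l : T' *m diag_mx l = diag_mx l *m T'.
    have -> : diag_mx l = P *m M *m adj P.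
      by rewrite ME !mulmxA PP mul1mx -mulmxA PP mulmx1.
    rewrite /T' !mulmxA -(mulmxA (P *m T)) PP' mulmx1 -(mulmxA P T) TM.
    by rewrite -(mulmxA (P *m M) (adj P)) PP' mulmx1 !mulmxA.
  have TE : T = adj P *m T' *m P.
    by rewrite /T' !mulmxA PP' mul1mx -mulmxA PP' mulmx1.
  clearbody T'.
  (* Entry (j, k) of T' vanishes unless l_j = l_k, and then D i has the same value at j and k. *)
  have T'D : T' *m D i = D i *m T'.
    apply/matrixP => j k; have /matrixP/(_ j k) := T'l.
    rewrite !mul_mx_diag !mul_diag_mx !(mxE, mulr1n).
    move: (T' j k) => t tl.
    have [ljk|ljk] := eqVneq (l 0 j) (l 0 k); first by rewrite -ljk mulrC.
    have /eqP : (l 0 k - l 0 j) * t = 0 by rewrite mulrBl -tl mulrC subrr.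
    rewrite mulf_eq0 subr_eq0 eq_sym (negbTE ljk) /= => /eqP ->.
    by rewrite mul0r mulr0.
  rewrite TE.
  rewrite /E !mulmxA -(mulmxA (adj P *m T')) PP mulmx1 -(mulmxA (adj P)) T'D.
  by rewrite -(mulmxA (adj P *m D i)) PP mulmx1 !mulmxA.
pose p i := vec F (E i *m coords 1).
have pE i y : p i * y = vec F (E i *m coords y).
  have -> : coords y = op_of (fun z => z * y) *m coords 1.
    by apply: (@vec_inj _ _ F);
      rewrite (vec_op_of (mulr_lin y)) !vec_coords mul1r.
  rewrite mulmxA -commE; first by rewrite -mulmxA (vec_op_of (mulr_lin y)).
  apply/matrixP => a b; rewrite ![in LHS]mxE ![in RHS]mxE.
  transitivity (co a (x * e b * y)).
    have := op_ofE (mulr_lin y) a (x * e b); move=> ->.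
    by apply: eq_bigr => k _; congr (_ * _); rewrite mxE.
  rewrite -mulrA (op_ofE (mull_lin x)).
  by apply: eq_bigr => k _; congr (_ * _); rewrite mxE.
have coords_p i : coords (p i) = E i *m coords 1.
  by apply: (@vec_inj _ _ F); rewrite vec_coords.
(* Each spectral projection occurs once for every index with its eigenvalue; dividing by the
   multiplicity compensates for this. *)
pose mult i : C := \sum_k (l 0 k == l 0 i)%:R.
have mult_neq0 i : mult i != 0.
  by rewrite /mult -natr_sum pnatr_eq0 (bigD1 i) //= eqxx.
exists (fun i => l 0 i / mult i), p; split=> [i|].
  split; first by rewrite pE coords_p mulmxA EE.
  have Eco j k : E i j k = co j (p i * e k).
    have ce m : coords (e k) m 0 = (m == k)%:R by rewrite mxE co_e.
    rewrite pE co_vec [RHS]mxE (bigD1 k) //= ce eqxx mulr1 big1 ?addr0 // =>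
      m mk.
    by rewrite ce (negbTE mk) mulr0.
  apply: mulr_e_inj => k; apply: co_inj => j.
  rewrite -Eco -hE [in RHS]mxE mxE Eco conj_co stM.
  by rewrite /co mulrA.
have -> : x = vec F (M *m coords 1).
  by rewrite (vec_op_of (mull_lin x)) vec_coords mulr1.
have -> : M = \sum_i (l 0 i / mult i) *: E i.
  rewrite ME /E; under eq_bigr do rewrite scalemxAl scalemxAr.
  rewrite -mulmx_suml -mulmx_sumr; congr (_ *m _ *m _).
  apply/matrixP => j k; rewrite summxE mxE.
  have [->|jk] := eqVneq j k; last first.
    by rewrite mulr0n big1 // => i _; rewrite !mxE (negbTE jk) mulr0n mulr0.
  rewrite mulr1n.
  transitivity (\sum_i (l 0 k / mult k) * (l 0 i == l 0 k)%:R).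
    by rewrite -mulr_sumr mulfVK.
  apply: eq_bigr => i _; rewrite !mxE eqxx mulr1n eq_sym.
  by case: eqVneq => [kk|]; rewrite ?mulr0 // /mult kk.
rewrite mulmx_suml; apply: co_inj => k; rewrite co_vec summxE co_sum.
by apply: eq_bigr => i _; rewrite -scalemxAl mxE coZ co_vec.
Qed.

(** Every basis vector is a combination of two self-adjoint elements, and the spectral projections
    of all of these are collected. The span is expressed as an induction principle over predicates
    closed under linear operations. *)
Lemma projections_span : exists s : seq F,
  (forall p, p \in s -> p * p = p /\ st p = p) /\
  forall Q : F -> Prop, Q 0 -> (forall x y, Q x -> Q y -> Q (x + y)) ->
    (forall a x, Q x -> Q (a *: x)) -> (forall p, p \in s -> Q p) ->
    forall x, Q x.
Proof.
pose spans (s : seq F) x := (forall p, p \in s -> p * p = p /\ st p = p) /\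
  forall Q : F -> Prop, Q 0 -> (forall x y, Q x -> Q y -> Q (x + y)) ->
    (forall a x, Q x -> Q (a *: x)) -> (forall p, p \in s -> Q p) -> Q x.
have sa x : st x = x -> exists s, spans s x.
  move=> /selfadjoint_projections [c [p [pp ->]]].
  exists [seq p i | i : 'I_n]; split=> [_ /mapP[i _ ->]|Q Q0 QD QZ Qp];
    first exact: pp.
  elim/big_ind: _ => [||i _]; [exact: Q0 | exact: QD | apply/QZ/Qp].
  by apply: map_f; rewrite mem_enum.
have comb s t x y a : spans s x -> spans t y -> spans (s ++ t) (x + a *: y).
  move=> [ss sx] [tt ty]; split=> [p|Q Q0 QD QZ Qp].
    by rewrite mem_cat => /orP[/ss|/tt].
  apply: (QD); first by apply: (sx Q Q0 QD QZ) => p ps; apply: Qp;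
    rewrite mem_cat ps.
  apply/QZ/(ty Q Q0 QD QZ) => p pt; apply: Qp; by rewrite mem_cat pt orbT.
have sall x : exists s, spans s x.
  pose y := x + st x; pose z := 'i *: (x - st x).
  have [s sy] : exists s, spans s y by apply: sa; rewrite stD stK addrC.
  have [t tz] : exists s, spans s z.
    have stB : st (x - st x) = st x - x.
      by rewrite -scaleN1r stD stZ rmorphN rmorph1 scaleN1r stK.
    by apply: sa; rewrite /z stZ stB conjCi scaleNr -scalerN opprB.
  have s0 : spans [::] 0 by split.
  (* The empty list stands for the summand 0, which puts x into the form that [comb] expects. *)
  exists ([::] ++ (s ++ t)).
  have -> : x = 0 + 2^-1 *: (y + (- 'i) *: z).
    rewrite add0r /z scalerA mulNr -expr2 sqrCi opprK scale1r /y.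
    rewrite addrACA subrr addr0 -mulr2n -(scaler_nat 2 x) scalerA mulVf
      ?scale1r //.
    by rewrite pnatr_eq0.
  exact/comb/comb.
have [f Hf] := boolp.choice (fun i => sall (e i)).
exists (flatten [seq f i | i : 'I_n]);
  split=> [p /flatten_mapP[i _]|Q Q0 QD QZ Qp x].
  by case: (Hf i) => ff _; exact: ff.
rewrite (co_exp x); elim/big_ind: _ => [||i _];
  [exact: Q0 | exact: QD | apply: (QZ)].
case: (Hf i) => _ /(_ Q Q0 QD QZ); apply=> p pf; apply: Qp.
by apply/flatten_mapP; exists i; rewrite ?mem_enum.
Qed.

End Projections.

(** * Disjoint copies of a quantum set *)

Section Power.
Variables (R : realType) (n : nat) (F : frame R n) (K : finType) (k0 : K).
Local Notation C := R[i].
Local Notation e := (@fe R n F).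

Definition pow_ops : starOps R := @StarOps R (K -> F)
  (fun=> 0) (fun=> 1) (fun x y k => x k + y k) (fun a x k => a *: x k)
  (fun x y k => x k * y k) (fun x k => st (x k)).

Lemma pow_star_alg : is_star_alg pow_ops.
Proof.
rewrite /is_star_alg /=; do !split.
- by move=> x y z; apply/funext => k; rewrite addrA.
- by move=> x y; apply/funext => k; rewrite addrC.
- by move=> x; apply/funext => k; rewrite add0r.
- by move=> x; apply/funext => k; rewrite scaleN1r subrr.
- by move=> x; apply/funext => k; rewrite scale1r.
- by move=> a b x; apply/funext => k; rewrite scalerA.
- by move=> a x y; apply/funext => k; rewrite scalerDr.
- by move=> a b x; apply/funext => k; rewrite scalerDl.
- by move=> x y z; apply/funext => k; rewrite mulrA.
- by move=> x; apply/funext => k; rewrite mul1r.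
- by move=> x; apply/funext => k; rewrite mulr1.
- by move=> x y z; apply/funext => k; rewrite mulrDl.
- by move=> x y z; apply/funext => k; rewrite mulrDr.
- by move=> a x y; apply/funext => k; rewrite scalerAl.
- by move=> a x y; apply/funext => k; rewrite scalerAr.
- by move=> x; apply/funext => k; rewrite stK.
- by move=> x y; apply/funext => k; rewrite stD.
- by move=> a x; apply/funext => k; rewrite stZ.
- by move=> x y; apply/funext => k; rewrite stM.
Qed.

Lemma pow_nz : sa_one pow_ops <> sa_zero pow_ops.
Proof.
by move/(congr1 (fun x => x k0)) => /= /eqP; rewrite oner_eq0.
Qed.

Definition pow_alg : starAlg R := carrier_star pow_star_alg pow_nz.

Definition pow_dim : nat := #|{: K * 'I_n}|.
Local Notation N := pow_dim.

(* The basis vector of index s is [e (pos s)] in the copy [lay s] of [F]. *)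
Definition lay (s : 'I_N) : K := (enum_val s).1.
Definition pos (s : 'I_N) : 'I_n := (enum_val s).2.
Definition idx (k : K) (i : 'I_n) : 'I_N := enum_rank (k, i).

Lemma lay_idx k i : lay (idx k i) = k.
Proof. by rewrite /lay /idx enum_rankK. Qed.
Lemma pos_idx k i : pos (idx k i) = i.
Proof. by rewrite /pos /idx enum_rankK. Qed.
Lemma idxK s : idx (lay s) (pos s) = s.
Proof. by rewrite /lay /pos /idx -surjective_pairing enum_valK. Qed.
Lemma idx_eq s t : (s == t) = (lay s == lay t) && (pos s == pos t).
Proof.
apply/eqP/andP => [->|[/eqP ll /eqP pp]]; first by rewrite !eqxx.
by rewrite -(idxK s) -(idxK t) ll pp.
Qed.

Lemma sum_idx (V : nmodType) (G : 'I_N -> V) :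
  \sum_s G s = \sum_k \sum_i G (idx k i).
Proof.
rewrite pair_bigA (reindex (fun p => idx p.1 p.2)) //=.
exists (fun s => (lay s, pos s)) => [[k i] _|s _] /=; last exact: idxK.
by rewrite lay_idx pos_idx.
Qed.

Lemma sum_idx_lay (V : nmodType) (G : 'I_N -> V) k :
  (forall s, lay s != k -> G s = 0) -> \sum_s G s = \sum_i G (idx k i).
Proof.
move=> G0; rewrite sum_idx (bigD1 k) //= [X in _ + X]big1 ?addr0 // => k' k'k.
by rewrite big1 // => i _; apply: G0; rewrite lay_idx.
Qed.

Definition pow_tau (x : pow_alg) : C := \sum_k tau (x k).
Definition pow_e (s : 'I_N) : pow_alg :=
  fun k => if k == lay s then e (pos s) else 0.

Let powM (x y : pow_alg) k : (x * y : pow_alg) k = x k * y k.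
Proof. by []. Qed.
Let powE a (x y : pow_alg) k : (a *: x + y : pow_alg) k = a *: x k + y k.
Proof. by []. Qed.
Let pow_sum (I : Type) (r : seq I) (P : pred I) (G : I -> pow_alg) k :
  (\sum_(i <- r | P i) G i) k = \sum_(i <- r | P i) G i k.
Proof. by apply: (big_morph (fun x : pow_alg => x k)). Qed.

Let tau0 : tau (0 : F) = 0.
Proof. by rewrite -(scale0r (1 : F)) tauZ mul0r. Qed.

Let pow_tauM (x y : pow_alg) : pow_tau (x * y) = \sum_k tau (x k * y k).
Proof. by []. Qed.

Let pow_tau_e s (x : pow_alg) :
  pow_tau (st (pow_e s) * x) = co (pos s) (x (lay s)).
Proof.
rewrite pow_tauM (bigD1 (lay s)) //= big1 ?addr0 => [|k ks].
  by rewrite /pow_e eqxx.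
by rewrite /pow_e (negbTE ks) st0 mul0r tau0.
Qed.

Definition pow_frame : frame R N.
Proof.
refine (@Frame R N pow_alg pow_tau pow_e _ _ _ _ _ _).
- move=> a x y; rewrite /pow_tau mulr_sumr -big_split.
  by apply: eq_bigr => k _; rewrite powE tauD tauZ.
- by move=> x y; rewrite !pow_tauM; apply: eq_bigr => k _; rewrite tauC.
- by move=> x; rewrite /pow_tau rmorph_sum; apply: eq_bigr => k _;
    exact: tau_st.
- move=> s t; rewrite pow_tau_e /pow_e idx_eq.
  by case: (_ == _) => /=; rewrite ?co_e // co0.
- move=> x; apply/funext => k; rewrite pow_sum.
  transitivity (\sum_s co (pos s) (x (lay s)) *: pow_e s k); last first.
    by apply: eq_bigr => s _; rewrite pow_tau_e.
  rewrite (@sum_idx_lay _ _ k) => [|s sk]; last first.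
    by rewrite /pow_e eq_sym (negbTE sk) scaler0.
  rewrite [LHS]co_exp; apply: eq_bigr => i _.
  by rewrite /pow_e lay_idx pos_idx eqxx.
- move=> x; under eq_bigr do rewrite -mulrA pow_tau_e.
  rewrite sum_idx; apply: eq_bigr => k _; rewrite -[RHS]tau_trace.
  apply: eq_bigr => i _; rewrite lay_idx pos_idx.
  by rewrite powM /pow_e lay_idx eqxx pos_idx /co mulrA.
Defined.

Local Notation XK := (frame_alg pow_frame).
Local Notation X := (frame_alg F).

Lemma pow_co s (x : pow_frame) : co s x = co (pos s) (x (lay s)).
Proof. exact: pow_tau_e. Qed.

Lemma pow_sc s t r : sc pow_frame s t r =
  if (lay t == lay s) && (lay r == lay s) then sc F (pos s) (pos t) (pos r)
    else 0.
Proof.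
rewrite /sc pow_co powM /= /pow_e.
rewrite ![lay s == _]eq_sym; case: (_ == _) => /=; last by rewrite mul0r co0.
by case: (_ == _) => //=; rewrite mulr0 co0.
Qed.

Lemma pow_sc_sum (V : lmodType C) (G : 'I_N -> 'I_N -> V) s :
  \sum_a \sum_b sc pow_frame s a b *: G a b =
  \sum_i \sum_j sc F (pos s) i j *: G (idx (lay s) i) (idx (lay s) j).
Proof.
rewrite (@sum_idx_lay _ _ (lay s)) => [|a al]; last first.
  by rewrite big1 // => b _; rewrite pow_sc (negbTE al) scale0r.
apply: eq_bigr => i _.
rewrite (@sum_idx_lay _ _ (lay s)) => [|b bl]; last first.
  by rewrite pow_sc (negbTE bl) andbF scale0r.
by apply: eq_bigr => j _; rewrite pow_sc !lay_idx !pos_idx eqxx.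
Qed.

Lemma pow_sc_sum_conj (G : 'I_N -> 'I_N -> C) s :
  \sum_a \sum_b G a b * Num.conj (sc pow_frame s a b) =
  \sum_i \sum_j G (idx (lay s) i) (idx (lay s) j) * Num.conj (sc F (pos s) i j).
Proof.
have := @pow_sc_sum C^o (fun a b => Num.conj (G a b)) s.
move=> /(congr1 Num.conj); rewrite !rmorph_sum => H.
transitivity (\sum_a Num.conj (\sum_b sc pow_frame s a b * Num.conj (G a b))).
  apply: eq_bigr => a _; rewrite rmorph_sum; apply: eq_bigr => b _.
  by rewrite rmorphM /= conjCK mulrC.
rewrite H; apply: eq_bigr => i _; rewrite rmorph_sum; apply: eq_bigr => j _.
by rewrite rmorphM /= conjCK mulrC.
Qed.

Definition blk (A : K -> K -> 'M[C]_n) : 'M[C]_N :=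
  \matrix_(s, t) A (lay s) (lay t) (pos s) (pos t).

Lemma blkE A k k' i j : blk A (idx k i) (idx k' j) = A k k' i j.
Proof. by rewrite mxE !lay_idx !pos_idx. Qed.

Lemma blk_mulv A (c : K -> C) (v : 'cV[C]_n) :
  blk A *m (\col_s (c (lay s) * v (pos s) 0))
  = \col_s (\sum_k c k *: (A (lay s) k *m v)) (pos s) 0.
Proof.
apply/matrixP => s j; rewrite !mxE sum_idx summxE; apply: eq_bigr => k _.
rewrite !mxE mulr_sumr; apply: eq_bigr => i _.
by rewrite !mxE lay_idx pos_idx mulrCA.
Qed.

Lemma adj_blk A : adj (blk A) = blk (fun k k' => adj (A k' k)).
Proof. by apply/matrixP => s t; rewrite !mxE. Qed.

Lemma eq_blk A A' : (forall k k', A k k' = A' k k') -> blk A = blk A'.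
Proof. by move=> AA; apply/matrixP => s t; rewrite !mxE AA. Qed.

(** Neither m nor m^* mixes copies. Hence an array of Schur idempotents is a Schur idempotent. *)
Lemma schur_blk A A' :
  schur XK (blk A) (blk A') = blk (fun k k' => schur X (A k k') (A' k k')).
Proof.
apply/matrixP => s t; rewrite [RHS]mxE !schurE.
transitivity (\sum_a \sum_b sc pow_frame s a b *: (\sum_c \sum_d
    (blk A a c * blk A' b d) * Num.conj (sc pow_frame t c d) : C^o)).
  apply: eq_bigr => a _; apply: eq_bigr => b _.
  rewrite scaler_sumr; apply: eq_bigr => c _.
  by rewrite scaler_sumr; apply: eq_bigr => d _; rewrite -mulrA.
rewrite pow_sc_sum; apply: eq_bigr => i _; apply: eq_bigr => j _.
rewrite pow_sc_sum_conj scaler_sumr; apply: eq_bigr => k _.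
rewrite scaler_sumr; apply: eq_bigr => l _.
by rewrite !blkE [LHS]mulrA.
Qed.

Lemma pow_eta s : fd_unit XK s 0 = fd_unit X (pos s) 0.
Proof. by rewrite !mxE pow_co. Qed.

End Power.
Arguments lay {n K} s.
Arguments pos {n K} s.
Arguments idx {n K} k i.

(** * Operators compatible with the involution *)

Section RealOperators.
Variables (R : realType) (n : nat) (F : frame R n).
Local Notation C := R[i].
Local Notation X := (frame_alg F).
Local Notation J := (fd_J X).

Definition real_mx (T : 'M[C]_n) := forall f, qbar X T f = T *m f.

Lemma real_mxP T :
  real_mx T <-> J *m map_mx Num.conj T *m map_mx Num.conj J = T.
Proof.
have E f : qbar X T f = J *m map_mx Num.conj T *m map_mx Num.conj J *m f.
  rewrite /qbar /fd_star !map_mxM !mulmxA; congr (_ *m _).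
  by apply/matrixP => i j; rewrite !mxE; exact: conjCK.
split=> [H|H f]; last by rewrite E H.
apply/matrixP => i j; have := H (delta_mx j 0); rewrite E.
by rewrite -!colE => /matrixP/(_ i 0); rewrite !mxE.
Qed.

Lemma real_op_of (f : F -> F) : linear f -> (forall x, st (f (st x)) = f x) ->
  real_mx (op_of f).
Proof.
move=> fl fs v; apply: (@vec_inj _ _ F).
by rewrite /qbar vec_star !(vec_op_of fl) vec_star fs.
Qed.

(** J is symmetric by traciality, so its adjoint is its complex conjugate, and the adjoint of the
    equation in [real_mxP] is the same equation for [adj T]. *)
Lemma real_adj T : real_mx T -> real_mx (adj T).
Proof.
move=> /real_mxP H; apply/real_mxP.
have JT : J^T = J by apply/matrixP => i j; rewrite !mxE co_st.
have adjJ : adj J = map_mx Num.conj J by rewrite /adj map_trmx JT.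
have adjJc : adj (map_mx Num.conj J) = J by rewrite -adjJ adj_mxK.
have -> : map_mx Num.conj (adj T) = adj (map_mx Num.conj T).
  by apply/matrixP => i j; rewrite !mxE.
by rewrite -[in RHS]H !adj_mulmx adjJ adjJc mulmxA.
Qed.

Lemma real_mx0 : real_mx 0.
Proof. by apply/real_mxP; rewrite map_mx0 mulmx0 mul0mx. Qed.

End RealOperators.

Lemma real_blk (R : realType) n (F : frame R n) (K : finType) (k0 : K)
    (A : K -> K -> 'M[R[i]]_n) :
  (forall k k', real_mx F (A k k')) -> real_mx (pow_frame F k0) (blk A).
Proof.
move=> hA; apply/real_mxP; apply/matrixP => s t.
have JE a b : fd_J (frame_alg (pow_frame F k0)) a b =
    if lay a == lay b then fd_J (frame_alg F) (pos a) (pos b) else 0.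
  rewrite !mxE pow_co; transitivity (co (pos a) (st (pow_e F k0 b (lay a))))
    => [//|]; rewrite /pow_e.
  by case: (_ == _); rewrite ?st0 ?co0.
have /real_mxP/matrixP/(_ (pos s) (pos t)) := hA (lay s) (lay t).
rewrite [X in _ = X -> _]/= => H; rewrite [RHS]mxE -H mxE [RHS]mxE.
rewrite (@sum_idx_lay _ _ _ _ (lay t)) => [|a al]; last first.
  by rewrite [X in _ * X]mxE JE (negbTE al) conjC0 mulr0.
apply: eq_bigr => j _; congr (_ * _); last first.
  by rewrite mxE [RHS]mxE JE lay_idx pos_idx eqxx.
rewrite mxE [RHS]mxE (@sum_idx_lay _ _ _ _ (lay s)) => [|a al]; last first.
  by rewrite JE eq_sym (negbTE al) mul0r.
apply: eq_bigr => i _; rewrite JE lay_idx pos_idx eqxx; congr (_ * _).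
by rewrite mxE [RHS]mxE blkE.
Qed.

(** * The graph *)

Section SchurFacts.
Variables (R : realType) (n : nat) (F : frame R n).
Local Notation C := R[i].
Local Notation X := (frame_alg F).
Local Notation eta := (fd_unit X).
Local Notation e := (@fe R n F).

Lemma schur_adj (A B : 'M[C]_n) :
  schur X (adj A) (adj B) = adj (schur X A B).
Proof.
rewrite /schur !adj_mulmx adj_mxK mulmxA; congr (_ *m _ *m _).
apply/matrixP; case/mxvec_indexP => i j; case/mxvec_indexP => k l.
by rewrite kronE [RHS]mxE [RHS]mxE kronE rmorphM !mxE.
Qed.

Lemma schur0r (A : 'M[C]_n) : schur X A 0 = 0.
Proof.
rewrite /schur (_ : kron A 0 = 0) ?mulmx0 ?mul0mx //.
apply/matrixP; case/mxvec_indexP => i j; case/mxvec_indexP => k l.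
by rewrite kronE !mxE mulr0.
Qed.

Lemma schur11 : schur X 1%:M 1%:M = 1%:M.
Proof.
rewrite /schur (_ : kron 1%:M 1%:M = 1%:M) ?mulmx1 ?mu_coisometry //.
apply/matrixP; case/mxvec_indexP => i j; case/mxvec_indexP => k l.
rewrite kronE !mxE mxvec_index_eq.
by case: (i == k) => /=; rewrite ?mul1r ?mul0r.
Qed.

Lemma schur01 : schur X 0 1%:M = 0.
Proof.
rewrite /schur (_ : kron 0 1%:M = 0) ?mulmx0 ?mul0mx //.
apply/matrixP; case/mxvec_indexP => i j; case/mxvec_indexP => k l.
by rewrite kronE !mxE mul0r.
Qed.

(** The complete quantum graph with loops, x |-> psi(x) 1. *)
Definition full_mx : 'M[C]_n := eta *m adj eta.

Let unit_tau_linear : linear (fun x : F => (tau x)%:A : F).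
Proof. by move=> a x y; rewrite tauD tauZ scalerDl scalerA. Qed.

Lemma full_mxE : full_mx = op_of (fun x : F => (tau x)%:A).
Proof.
apply/matrixP => i j.
by rewrite mxE big_ord1 !mxE coZ conj_co st1 mul1r mulrC.
Qed.

Lemma schur_full : schur X full_mx full_mx = full_mx.
Proof.
apply/matrixP => p q;
  rewrite full_mxE (schur_op_of unit_tau_linear unit_tau_linear).
rewrite [RHS]mxE; congr (co p _).
rewrite -[e q in RHS]mulr1 -parseval scaler_suml; apply: eq_bigr => r _.
by rewrite mulr_algr scalerA mulrC /co mulr1.
Qed.

Lemma real_full : real_mx F full_mx.
Proof.
rewrite full_mxE; apply: real_op_of => // x.
by rewrite st_scalar tau_st conjCK.
Qed.

Lemma adj_full : adj full_mx = full_mx.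
Proof. by rewrite /full_mx adj_mulmx adj_mxK. Qed.

Lemma full_eta : full_mx *m eta = n%:R *: eta.
Proof.
rewrite /full_mx -mulmxA; apply/matrixP => i j;
  rewrite (ord1 j) mxE big_ord1 mulrC.
rewrite -(@tau_vec _ _ F) vec_unit st1 mulr1 tau1.
by rewrite [RHS]mxE.
Qed.

Lemma real_mx1 : real_mx F 1%:M.
Proof. by move=> f; rewrite /qbar !mul1mx; apply: (@vec_inj _ _ F);
  rewrite !vec_star stK. Qed.

Lemma intertwines_full (B : starAlg R) (V : 'M[B]_n) :
  qperm F V -> intertwines V full_mx.
Proof.
move=> hV; rewrite /intertwines /full_mx embM mulmxA (qperm_unit hV) -mulmxA.
congr (_ *m _).
have : dag V *m emb B eta = emb B eta.
  by rewrite -[in LHS](qperm_unit hV) mulmxA (qperm_adjmulV hV) mul1mx.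
by move/(congr1 (@dag _ _ _ _)); rewrite dagM dagK dag_emb.
Qed.

End SchurFacts.

Section Graph.
Variables (R : realType) (n : nat) (F : frame R n) (u : 'M[F]_n).
Local Notation C := R[i].
Local Notation X := (frame_alg F).
Local Notation eta := (fd_unit X).
Hypothesis hu : hopf u.
Let qu : qperm F u := hopf_qperm hu.
Variable s : seq F.
Hypothesis s_proj : forall p, p \in s -> p * p = p /\ st p = p.
Hypothesis s_span : forall Q : F -> Prop, Q 0 ->
  (forall x y, Q x -> Q y -> Q (x + y)) -> (forall a x, Q x -> Q (a *: x)) ->
  (forall p, p \in s -> Q p) -> forall x, Q x.

Local Notation L := (size s).+1.
Local Notation K := (bool * 'I_L)%type.

Let n_gt0 : (0 < n)%N.
Proof.
rewrite lt0n -(pnatr_eq0 C) -(tau1 F); exact: tau1_neq0.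
Qed.

(** The leading 0 shifts the projections to the indices 1 to [size s], so that row 0 of [low_block]
    contains the operators of all of them. *)
Definition proj_nth (j : 'I_L) : F := nth 0 (0 :: s) j.

Let proj_nthP j : proj_nth j * proj_nth j = proj_nth j /\ st (proj_nth j) =
  proj_nth j.
Proof.
rewrite /proj_nth; case: j => -[|j] jL /=; first by rewrite mulr0 st0.
exact/s_proj/mem_nth.
Qed.

(** The adjoint below the diagonal makes the graph undirected; the zero diagonal leaves these copies
    without loops. *)
Definition low_block (i j : 'I_L) : 'M[C]_n :=
  if (i < j)%N then conv_mx u (proj_nth j)
  else if (j < i)%N then adj (conv_mx u (proj_nth i)) else 0.

Definition cross_block (i j : 'I_L) : 'M[C]_n :=
  if (j < i)%N then full_mx F else if i == j then 1%:M else 0.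

(* Vertices are 2L copies of the quantum group.  Only the copies (true, i)
   carry loops, and the cross blocks give all copies different degrees, so
   that a quantum automorphism preserves each copy; the identity blocks then
   make it act in the same way on all copies, and the blocks of
   [low_block] make this action commute with convolution by projections. *)
Definition block (k k' : K) : 'M[C]_n :=
  match k.1, k'.1 with
  | false, false => low_block k.2 k'.2
  | true, true => 1%:M
  | false, true => cross_block k.2 k'.2
  | true, false => cross_block k'.2 k.2
  end.

Let k0 : K := (true, ord0).
Local Notation FX := (pow_frame F k0).
Local Notation XK := (frame_alg FX).

Definition graph_mx := blk block.

(** A single case analysis for Schur idempotence, reality and commutation with u, all of which pass
    to adjoints. *)
Lemma block_ind (Q : 'M[C]_n -> Prop) : Q 0 -> Q 1%:M -> Q (full_mx F) ->
  (forall j, Q (conv_mx u (proj_nth j))) ->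
  (forall T, Q T -> Q (adj T)) -> forall k k', Q (block k k').
Proof.
move=> Q0 Q1 QJ Qp Qa [[] i] [[] j] //=; rewrite /block /=.
- by rewrite /cross_block; case: ifP => // _; case: ifP.
- by rewrite /cross_block; case: ifP => // _; case: ifP.
- rewrite /low_block; case: ifP => // _; case: ifP => // _; exact: Qa.
Qed.

Lemma adj_block k k' : adj (block k' k) = block k k'.
Proof.
have adj0 : adj (0 : 'M[C]_n) = 0 by rewrite /adj map_mx0 trmx0.
have adj_cross i j : adj (cross_block i j) = cross_block i j.
  rewrite /cross_block; case: ifP => _; first exact: adj_full.
  by case: ifP => _; rewrite ?adj_mx1 ?adj0.
case: k k' => [[] i] [[] j]; rewrite /block /= ?adj_cross //;
  first exact: adj_mx1.
rewrite /low_block; case: (ltngtP i j) => _; rewrite ?adj_mxK ?adj0 //.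
Qed.

Lemma graph_undirected : is_undirected_qgraph XK graph_mx.
Proof.
split; last by rewrite /graph_mx adj_blk; apply: eq_blk => k k';
  rewrite adj_block.
split.
  rewrite schur_blk; apply: eq_blk => k k'.
  apply: (block_ind (Q := fun T => schur X T T = T)) => [||||T TT].
  - exact: schur0r.
  - exact: schur11.
  - exact: schur_full.
  - by move=> j; rewrite schur_conv //; case: (proj_nthP j) => ->.
  - by rewrite schur_adj TT.
apply: real_blk => k k'; apply: block_ind.
- exact: real_mx0.
- exact: real_mx1.
- exact: real_full.
- move=> j; apply: real_op_of => [|x]; first exact: conv_linear.
  by rewrite st_conv_st //; case: (proj_nthP j) => _ ->.
- exact: real_adj.
Qed.

Lemma block_intertwines k k' : intertwines u (block k k').
Proof.
apply: block_ind.
- by rewrite /intertwines /emb map_mx0 mulmx0 mul0mx.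
- exact: intertwines1.
- exact: intertwines_full.
- by move=> j; apply: intertwines_conv.
- exact: (intertwines_adj qu).
Qed.

Definition pow_mx : 'M[F]_(pow_dim n K) := \matrix_(a, b)
  if lay a == lay b then u (pos a) (pos b) else 0.

Lemma pow_mx_idx k i b :
  pow_mx (idx k i) b = if lay b == k then u i (pos b) else 0.
Proof. by rewrite mxE lay_idx pos_idx eq_sym. Qed.

Lemma sum_pow_mx (V : nmodType) a (G : F -> 'I_(pow_dim n K) -> V) :
  (forall b, G 0 b = 0) ->
  \sum_b G (pow_mx a b) b = \sum_j G (u (pos a) j) (idx (lay a) j).
Proof.
move=> G0; rewrite (@sum_idx_lay _ _ _ _ (lay a)) => [|b ab]; last first.
  by rewrite mxE eq_sym (negbTE ab) G0.
by apply: eq_bigr => j _; rewrite mxE lay_idx pos_idx eqxx.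
Qed.

Lemma sum_pow_mxl (V : nmodType) b (G : F -> 'I_(pow_dim n K) -> V) :
  (forall a, G 0 a = 0) ->
  \sum_a G (pow_mx a b) a = \sum_j G (u j (pos b)) (idx (lay b) j).
Proof.
move=> G0; rewrite (@sum_idx_lay _ _ _ _ (lay b)) => [|a ab]; last first.
  by rewrite mxE (negbTE ab) G0.
by apply: eq_bigr => j _; rewrite mxE lay_idx pos_idx eqxx.
Qed.

Lemma pow_mx_qperm : qperm FX pow_mx.
Proof.
split.
- apply/matrixP => a b; rewrite mxE.
  rewrite (sum_pow_mx a (G := fun x c => x * dag pow_mx c b)); last first.
    by move=> c; rewrite mul0r.
  rewrite !mxE idx_eq.
  have [ab|ab] := eqVneq (lay a) (lay b); last first.
    rewrite big1 // => j _.
    by rewrite dagE mxE lay_idx eq_sym (negbTE ab) st0 mulr0.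
  rewrite andTb.
  have /matrixP/(_ (pos a) (pos b)) := qperm_mulVadj qu; rewrite !mxE => <-.
  by apply: eq_bigr => j _;
    rewrite !dagE [pow_mx _ _]mxE lay_idx pos_idx ab eqxx.
- apply/matrixP => a b; rewrite mxE.
  rewrite (sum_pow_mxl b (G := fun x c => dag pow_mx a c * x)); last first.
    by move=> c; rewrite mulr0.
  rewrite !mxE idx_eq.
  have [ab|ab] := eqVneq (lay a) (lay b); last first.
    rewrite big1 // => j _.
    by rewrite dagE mxE lay_idx eq_sym (negbTE ab) st0 mul0r.
  rewrite andTb.
  have /matrixP/(_ (pos a) (pos b)) := qperm_adjmulV qu; rewrite !mxE => <-.
  by apply: eq_bigr => j _;
    rewrite !dagE [pow_mx _ _]mxE lay_idx pos_idx ab eqxx.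
- move=> p k l; rewrite pow_sc_sum.
  under eq_bigr do under eq_bigr do rewrite !pow_mx_idx.
  rewrite (sum_pow_mx p (G := fun x q => sc FX q k l *: x)); last first.
    by move=> q; rewrite scaler0.
  under [RHS]eq_bigr do rewrite pow_sc lay_idx pos_idx.
  have [kp|kp] := eqVneq (lay k) (lay p); last first.
    rewrite big1 => [|i _]; last by rewrite big1 // => j _;
      rewrite mul0r scaler0.
    by rewrite big1 // => j _; rewrite scale0r.
  have [lp|lp] := eqVneq (lay l) (lay p); last first.
    rewrite big1 => [|i _]; last by rewrite big1 // => j _;
      rewrite mulr0 scaler0.
    by rewrite big1 // => j _; rewrite scale0r.
  exact: (hopf_mul hu).
- apply/matrixP => a j; rewrite mulE_emb embE ord1.
  rewrite (sum_pow_mx a (G := fun x b => fd_unit XK b 0 *: x)); last first.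
    by move=> b; rewrite scaler0.
  have /matrixP/(_ (pos a) 0) := hopf_unit hu;
    rewrite mulE_emb embE pow_eta => <-.
  by apply: eq_bigr => i _; rewrite pow_eta pos_idx.
Qed.

Lemma pow_mx_intertwines : intertwines pow_mx graph_mx.
Proof.
apply/matrixP => a b; rewrite mulE_emb mul_embE.
rewrite (sum_pow_mx a (G := fun x c => graph_mx c b *: x)); last first.
  by move=> c; rewrite scaler0.
rewrite (sum_pow_mxl b (G := fun x c => graph_mx a c *: x)); last first.
  by move=> c; rewrite scaler0.
have /matrixP/(_ (pos a) (pos b)) := block_intertwines (lay a) (lay b).
rewrite mulE_emb mul_embE => H.
transitivity (\sum_j block (lay a) (lay b) j (pos b) *: u (pos a) j).
  by apply: eq_bigr => j _; rewrite mxE lay_idx pos_idx.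
by rewrite H; apply: eq_bigr => j _; rewrite mxE lay_idx pos_idx.
Qed.


(** * Degrees of the copies *)

Definition cross_deg (i j : 'I_L) : nat :=
  if (j < i)%N then n else (i == j).

Lemma cross_block_eta i j : cross_block i j *m eta = (cross_deg i j)%:R *: eta.
Proof.
rewrite /cross_block /cross_deg; case: ifP => _; first exact: full_eta.
by case: eqP => _; rewrite ?mul1mx ?scale1r ?mul0mx ?scale0r.
Qed.

(** Column i' contributes the strict increase, from 0 to the diagonal 1; in the other columns
    entries do not decrease, because 1 <= n. *)
Lemma cross_deg_row_lt (i i' : 'I_L) : (i < i')%N ->
  (\sum_j cross_deg i j < \sum_j cross_deg i' j)%N.
Proof.
move=> ii'; rewrite (bigD1 i') //= [X in (_ < X)%N](bigD1 i') //=.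
have f : (i' < i)%N = false by rewrite ltnNge (ltnW ii').
rewrite /cross_deg ltnn eqxx f /=.
rewrite (_ : i == i' = false) ?add0n ?add1n ?ltnS; last first.
  by apply/eqP => H; rewrite H ltnn in ii'.
apply: leq_sum => j _; case: ifP => ji.
  by rewrite (ltn_trans ji ii').
case: ifP => [_|]; first by case: (_ == _).
by case: eqP => // <-; rewrite ii'.
Qed.

Lemma cross_deg_col_lt (j j' : 'I_L) : (j < j')%N ->
  (\sum_i cross_deg i j' < \sum_i cross_deg i j)%N.
Proof.
move=> jj'; rewrite (bigD1 j) //= [X in (_ < X)%N](bigD1 j) //=.
have f : (j' < j)%N = false by rewrite ltnNge (ltnW jj').
rewrite /cross_deg ltnn eqxx f /=.
rewrite (_ : j == j' = false) ?add0n ?add1n ?ltnS; last first.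
  by apply/eqP => H; rewrite H ltnn in jj'.
apply: leq_sum => i _; case: ifP => ji.
  by rewrite (ltn_trans jj' ji).
by case: eqP => // ->; rewrite jj'.
Qed.

Lemma cross_deg_row_gt0 i : (0 < \sum_j cross_deg i j)%N.
Proof. by rewrite (bigD1 i) //= /cross_deg ltnn eqxx. Qed.

(** The sign separates the two halves: row sums are positive, negated column sums are at most 0.
    Within a half, the triangular shape makes the sums strictly monotone. *)
Definition layer_deg (k : K) : C :=
  if k.1 then - (\sum_i cross_deg i k.2)%:R else (\sum_j cross_deg k.2 j)%:R.

Lemma layer_deg_inj : injective layer_deg.
Proof.
have pos i : 0 < (\sum_j cross_deg i j)%:R :> C
  by rewrite ltr0n cross_deg_row_gt0.
have npos j : - (\sum_i cross_deg i j)%:R <= 0 :> C by rewrite oppr_le0 ler0n.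
case=> [] [] i [] [] j; rewrite /layer_deg /= => H.
- move/oppr_inj/eqP: H; rewrite eqr_nat;
    case: (ltngtP i j) => [ij|ij|/val_inj->//].
    by rewrite gtn_eqF // cross_deg_col_lt.
  by rewrite ltn_eqF // cross_deg_col_lt.
- by have := lt_le_trans (pos j); rewrite -H => /(_ _ (npos i)); rewrite ltxx.
- by have := lt_le_trans (pos i); rewrite H => /(_ _ (npos j)); rewrite ltxx.
- move/eqP: H; rewrite eqr_nat; case: (ltngtP i j) => [ij|ij|/val_inj->//].
    by rewrite ltn_eqF // cross_deg_row_lt.
  by rewrite gtn_eqF // cross_deg_row_lt.
Qed.

Let pv (c : K -> C) : 'cV[C]_(pow_dim n K) := \col_a (c (lay a) * eta (pos a)
  0).

(** The Schur product with the identity erases all blocks between different copies. The diagonal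
    blocks are 1 or 0, so the result is the projection onto the looped copies, and it commutes with
    whatever quantum permutation commutes with [graph_mx]. *)
Let loops := schur XK graph_mx 1%:M.

Let loopsE : loops = blk (fun k k' => if (k == k') && k.1 then 1%:M else 0).
Proof.
have -> : loops = schur XK (blk block) (blk (fun k k' =>
  if k == k' then 1%:M else 0)).
  congr (schur _ _ _); apply/matrixP => a b; rewrite !mxE idx_eq.
  by case: (_ == _); rewrite mxE.
rewrite schur_blk; apply: eq_blk => k k'.
have [<-|_] := eqVneq k k'; last by rewrite schur0r.
case: k => -[] i; rewrite /block /=; first exact: schur11.
by rewrite /low_block ltnn schur01.
Qed.

Let loops_pv c : loops *m pv c = pv (fun k => if k.1 then c k else 0).
Proof.
rewrite loopsE blk_mulv; apply/matrixP => a j; rewrite !mxE summxE.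
rewrite (bigD1 (lay a)) //= big1 ?addr0 => [|k ka]; last first.
  by rewrite eq_sym (negbTE ka) /= mul0mx scaler0 mxE.
rewrite eqxx /=; case: ifP => _; rewrite ?mul1mx ?mul0mx ?mxE ?mulr0 ?mul0r //.
Qed.

Let pvB c c' : pv c - pv c' = pv (fun k => c k - c' k).
Proof. by apply/matrixP => a j; rewrite !mxE mulrBl. Qed.

Let eta_pv : fd_unit XK = pv (fun=> 1).
Proof. by apply/matrixP => a j; rewrite (ord1 j) pow_eta [RHS]mxE mul1r. Qed.

(** The eigenvector condition is required only where c is nonzero; this keeps the blocks of
    [low_block] out of the degree count. *)
Let block_pv c (w : K -> K -> C) k :
  (forall k', c k' != 0 -> block k k' *m eta = w k k' *: eta) ->
  forall a, lay a = k ->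
  (graph_mx *m pv c) a 0 = (\sum_k' c k' * w k k') * eta (pos a) 0.
Proof.
move=> H a ak; rewrite /graph_mx blk_mulv mxE ak summxE mulr_suml.
apply: eq_bigr => k' _; have [->|/H E] := eqVneq (c k') 0.
  by rewrite scale0r !mul0r mxE.
by rewrite E scalerA mxE.
Qed.

Let sum_K (G : K -> C) :
  \sum_k G k = \sum_i G (true, i) + \sum_i G (false, i).
Proof.
transitivity (\sum_b \sum_i G (b, i)).
  by rewrite pair_bigA; apply: eq_bigr => -[].
by rewrite (bigD1 true) //= (bigD1 false) //= [X in _ + (_ + X)]big1 ?addr0 //
  => -[].
Qed.

Let hi (k : K) : C := if k.1 then 1 else 0.
Let lo (k : K) : C := if k.1 then 0 else 1.

(** Degrees of unlooped copies into looped ones, minus degrees in the opposite direction, written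
    with [loops], [graph_mx] and the unit alone so that V fixes the vector. *)
Let deg_vec := (1%:M - loops) *m (graph_mx *m (loops *m fd_unit XK))
             - loops *m (graph_mx *m ((1%:M - loops) *m fd_unit XK)).

Let deg_vecE : deg_vec = pv layer_deg.
Proof.
have e_hi : loops *m fd_unit XK = pv hi by rewrite eta_pv loops_pv.
have e_lo : (1%:M - loops) *m fd_unit XK = pv lo.
  rewrite mulmxBl mul1mx e_hi eta_pv pvB; congr pv; apply/funext => k.
  by rewrite /hi /lo; case: k.1; rewrite ?subrr ?subr0.
have loops_row (v : 'cV[C]_(pow_dim n K)) a :
    (loops *m v) a 0 = if (lay a).1 then v a 0 else 0.
  rewrite loopsE mxE (@sum_idx_lay _ _ _ _ (lay a)) => [|b ab]; last first.
    by rewrite mxE eq_sym (negbTE ab) /= mxE mul0r.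
  rewrite (bigD1 (pos a)) //= big1 ?addr0 => [|i ia].
    rewrite mxE idxK eqxx /=; case: ifP => _; last by rewrite mxE mul0r.
    by rewrite mxE eqxx mul1r.
  rewrite mxE lay_idx pos_idx eqxx /=; case: ifP => _;
    last by rewrite mxE mul0r.
  by rewrite mxE eq_sym (negbTE ia) mul0r.
rewrite /deg_vec e_hi e_lo; apply/matrixP => a j; rewrite (ord1 j).
have E0 (v w z : 'cV[C]_(pow_dim n K)) : (v - w - z) a 0 =
  v a 0 - w a 0 - z a 0.
  by rewrite !mxE.
rewrite mulmxBl mul1mx E0 !loops_row [RHS]mxE.
case E : (lay a) => [[] i] /=.
  rewrite subrr sub0r (@block_pv lo (fun _ k' =>
    (cross_deg k'.2 i)%:R) (true, i)) //.
    rewrite sum_K big1 ?add0r => [|i' _]; last by rewrite /lo mul0r.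
    under eq_bigr do rewrite /lo mul1r.
    by rewrite -natr_sum -mulNr.
  move=> [[] i']; rewrite /lo /= ?eqxx // => _.
  exact: cross_block_eta.
rewrite subr0 subr0 (@block_pv hi (fun _ k' =>
  (cross_deg i k'.2)%:R) (false, i)) //.
  rewrite sum_K [X in _ + X]big1 ?addr0 => [|i' _]; last by rewrite /hi mul0r.
  under eq_bigr do rewrite /hi mul1r.
  by rewrite -natr_sum.
move=> [[] i']; rewrite /hi /= ?eqxx // => _.
exact: cross_block_eta.
Qed.

(** * Quantum automorphisms of the graph *)

Section Universality.
Variables (B : starAlg R) (V : 'M[B]_(pow_dim n K)).
Hypothesis qV : qperm FX V.
Hypothesis V_graph : intertwines V graph_mx.

Let V_fixes : fixes V (pv layer_deg).
Proof.
have V_loops : intertwines V loops.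
  by apply: (intertwines_schur qV) => //; exact: intertwines1.
have V_unit : fixes V (fd_unit XK) by exact: (qperm_unit qV).
have V_c : intertwines V (1%:M - loops).
  by apply: intertwinesB => //; exact: intertwines1.
by rewrite -deg_vecE; apply: fixesB; do 3?apply: fixes_mul.
Qed.

(** Left multiplication by the fixed vector of degrees is diagonal, with a different scalar on every
    copy. Commutation with V therefore multiplies V_ab by a nonzero difference of degrees and yields
    0. *)
Lemma preserves_layers a b : lay a != lay b -> V a b = 0.
Proof.
have LE c d : lmul_mx FX (pv layer_deg) c d = (c == d)%:R * layer_deg (lay c).
  rewrite lmul_mxE.
  have [cd|cd] := eqVneq (lay c) (lay d); last first.
    rewrite big1 => [|k _]; last first.
      by rewrite pow_sc [lay d == _]eq_sym (negbTE cd) andbF mulr0.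
    by rewrite idx_eq (negbTE cd) mul0r.
  rewrite (@sum_idx_lay _ _ _ _ (lay c)) => [|k kc]; last first.
    by rewrite pow_sc (negbTE kc) mulr0.
  rewrite idx_eq cd eqxx andTb.
  transitivity (layer_deg (lay d) * \sum_i eta i 0 * sc F (pos c) i (pos d)).
    rewrite mulr_sumr; apply: eq_bigr => i _.
    by rewrite pow_sc mxE lay_idx pos_idx cd !eqxx /= mulrA.
  rewrite -(lmul_mxE F eta) mxE vec_unit mul1r co_e mulrC //.
move=> ab; have /matrixP/(_ a b) := intertwines_lmul qV V_fixes.
rewrite mulE_emb mul_embE.
rewrite (bigD1 b) //= big1 ?addr0 => [|c cb]; last first.
  by rewrite LE (negbTE cb) mul0r scale0r.
rewrite (bigD1 a) //= big1 ?addr0 => [|c ca]; last first.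
  by rewrite LE eq_sym (negbTE ca) mul0r scale0r.
rewrite !LE !eqxx !mul1r => /eqP; rewrite -subr_eq0 -scalerBl => H.
have d : layer_deg (lay b) - layer_deg (lay a) != 0.
  by rewrite subr_eq0; apply: contra ab => /eqP/layer_deg_inj ->.
by apply: (scalerI d); rewrite scaler0; apply/eqP.
Qed.

Let Vk k : 'M[B]_n := \matrix_(i, j) V (idx k i) (idx k j).

Let Vk_block k k' : Vk k *m emb B (block k k') = emb B (block k k') *m Vk k'.
Proof.
apply/matrixP => i j; rewrite mulE_emb mul_embE.
have /matrixP/(_ (idx k i) (idx k' j)) := V_graph; rewrite mulE_emb mul_embE.
rewrite (@sum_idx_lay _ _ _ _ k) => [|c ck]; last first.
  by rewrite preserves_layers ?scaler0 // lay_idx eq_sym.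
rewrite (@sum_idx_lay _ _ _ _ k') => [|c ck]; last first.
  by rewrite preserves_layers ?scaler0 // lay_idx.
move=> H.
transitivity (\sum_i0 graph_mx (idx k i0) (idx k' j) *: V (idx k i) (idx k i0)).
  by apply: eq_bigr => c _; rewrite blkE mxE.
by rewrite H; apply: eq_bigr => c _; rewrite blkE mxE.
Qed.

Let V0 := Vk k0.

Let VkE k : Vk k = V0.
Proof.
have T i : Vk (true, i) = V0.
  by have := Vk_block (true, i) k0; rewrite /block /= emb1 mulmx1 mul1mx.
case: k => [[] i] //; rewrite -(T i).
(* The diagonal cross block is the identity; it ties each unlooped copy to the looped copy of the
   same index. *)
have := Vk_block (false, i) (true, i).
by rewrite /block /= /cross_block ltnn eqxx emb1 mulmx1 mul1mx.
Qed.

Let VE a b : V a b = if lay a == lay b then V0 (pos a) (pos b) else 0.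
Proof.
have [ab|ab] := eqVneq (lay a) (lay b); last exact: preserves_layers.
by rewrite -(VkE (lay a)) mxE idxK ab idxK.
Qed.

Let V0E i j : V0 i j = V (idx k0 i) (idx k0 j).
Proof. by rewrite mxE. Qed.

Let V0_qperm : qperm F V0.
Proof.
have delta i j : (1%:M : 'M[B]_(pow_dim n K)) (idx k0 i) (idx k0 j) =
  (1%:M : 'M[B]_n) i j.
  by rewrite !mxE idx_eq !lay_idx !pos_idx eqxx.
split.
- apply/matrixP => i j; rewrite -delta -(qperm_mulVadj qV) mxE [RHS]mxE.
  rewrite (@sum_idx_lay _ _ _ _ k0) => [|c ck]; last first.
    by rewrite preserves_layers ?mul0r // lay_idx eq_sym.
  by apply: eq_bigr => l _; rewrite !dagE !V0E.
- apply/matrixP => i j; rewrite -delta -(qperm_adjmulV qV) mxE [RHS]mxE.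
  rewrite (@sum_idx_lay _ _ _ _ k0) => [|c ck]; last first.
    by rewrite (preserves_layers (a := c)) ?mulr0 // lay_idx.
  by apply: eq_bigr => l _; rewrite !dagE !V0E.
- move=> p k l; have := qperm_mul qV (idx k0 p) (idx k0 k) (idx k0 l).
  rewrite pow_sc_sum (@sum_idx_lay _ _ _ _ k0) => [H|q qk]; last first.
    by rewrite preserves_layers ?scaler0 // lay_idx eq_sym.
  transitivity (\sum_i \sum_j sc F p i j *:
      (V (idx k0 i) (idx k0 k) * V (idx k0 j) (idx k0 l))).
    by apply: eq_bigr => i _; apply: eq_bigr => j _; rewrite !V0E.
  move: H; rewrite lay_idx pos_idx => ->; apply: eq_bigr => q _.
  by rewrite V0E pow_sc !lay_idx !pos_idx eqxx.
- apply/matrixP => i j; rewrite (ord1 j) mulE_emb embE.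
  have /matrixP/(_ (idx k0 i) 0) := qperm_unit qV; rewrite mulE_emb embE.
  rewrite pow_eta pos_idx (@sum_idx_lay _ _ _ _ k0) => [<-|c ck]; last first.
    by rewrite preserves_layers ?scaler0 // lay_idx eq_sym.
  by apply: eq_bigr => l _; rewrite V0E pow_eta pos_idx.
Qed.

Let V0_conv a : intertwines V0 (conv_mx u a).
Proof.
have convD x y : conv_mx u (x + y) = conv_mx u x + conv_mx u y.
  by rewrite -[x in LHS]scale1r conv_mx_linear scale1r.
have conv0 : conv_mx u 0 = 0.
  by apply: (addrI (conv_mx u 0)); rewrite -convD !addr0.
move: a; apply: s_span => [|x y Hx Hy|a x Hx|p ps].
- by rewrite conv0 /intertwines /emb map_mx0 mulmx0 mul0mx.
- by rewrite convD; apply: intertwinesD.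
- by rewrite -[a *: x]addr0 conv_mx_linear conv0 addr0; apply: intertwinesZ.
(* The successor accounts for the leading 0 in [proj_nth]; as j is positive, block (0, j) of
   [low_block] is the operator of p. *)
have jL : ((index p s).+1 < L)%N by rewrite ltnS index_mem.
pose j : 'I_L := Ordinal jL.
have := Vk_block (false, ord0) (false, j); rewrite !VkE.
by rewrite /block /= /low_block /= /proj_nth /= nth_index.
Qed.

Lemma graph_factor : exists pi : F -> B,
  [/\ linear pi, {morph pi : x y / x * y}, {morph pi : x / st x >-> st x},
      pi 1 = 1 & forall a b, pi (pow_mx a b) = V a b].
Proof.
have V0_leg p : intertwines V0 (leg_mx u p).
  by rewrite -conv_mx_st_e; exact: V0_conv.
have [pi [pil pim pis pi1 piu]] := qperm_factor hu V0_qperm V0_leg.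
exists pi; split=> // a b; rewrite VE mxE; case: ifP => // _.
by have := pil (-1) 0 0; rewrite !scaleN1r !addNr.
Qed.

End Universality.

End Graph.

(** * Coordinates of a finite quantum group *)

Section QutRel.
Variables (R : realType) (n : nat) (F : frame R n) (B0 : starOps R).
Hypothesis hB : is_star_alg B0.
Hypothesis nz : sa_one B0 <> sa_zero B0.
Local Notation C := R[i].
Local Notation X := (frame_alg F).
Local Notation B := (carrier_star hB nz).
Variables (A : 'M[C]_n) (V : 'I_n -> 'I_n -> sa_car B0).

Let W : 'M[B]_n := \matrix_(i, j) (V i j : B).
Let WE i j : W i j = V i j. Proof. by rewrite mxE. Qed.

Let delta_scale i j : (if i == j then 1 else 0 : C) *: (1 : B) =
  (1%:M : 'M[B]_n) i j.
Proof. by rewrite mxE; case: (i == j); rewrite ?scale1r ?scale0r. Qed.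

Lemma qut_relP : qut_rel X A B0 V <-> qperm F W /\ intertwines W A.
Proof.
pose r1 := forall i j, \sum_k W i k * st (W j k) =
  (if i == j then 1 else 0 : C) *: (1 : B).
pose r2 := forall i j, \sum_k st (W k i) * W k j =
  (if i == j then 1 else 0 : C) *: (1 : B).
pose r3 := forall p k l, \sum_i \sum_j fd_mu X p (mxvec_index i j) *: (W i k *
  W j l)
           = \sum_q fd_mu X q (mxvec_index k l) *: W p q.
pose r4 := forall i, \sum_j fd_unit X j 0 *: W i j = fd_unit X i 0 *: (1 : B).
pose r5 := forall i j, \sum_k A k j *: W i k = \sum_k A i k *: W k j.
have -> : qut_rel X A B0 V <-> [/\ r1, r2, r3, r4 & r5].
  split=> -[h1 h2 h3 h4 h5]; split.
  - by move=> i j; under eq_bigr do rewrite !WE; exact: h1.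
  - by move=> i j; under eq_bigr do rewrite !WE; exact: h2.
  - move=> p k l; under eq_bigr do under eq_bigr do rewrite !WE.
    by under [RHS]eq_bigr do rewrite !WE; exact: h3.
  - by move=> i; under eq_bigr do rewrite !WE; exact: h4.
  - move=> i j; under eq_bigr do rewrite !WE.
    by under [RHS]eq_bigr do rewrite !WE; exact: h5.
  - by move=> i j; have := h1 i j; under eq_bigr do rewrite !WE.
  - by move=> i j; have := h2 i j; under eq_bigr do rewrite !WE.
  - move=> p k l; have := h3 p k l;
      under eq_bigr do under eq_bigr do rewrite !WE.
    by under [X in _ = X -> _]eq_bigr do rewrite !WE.
  - by move=> i; have := h4 i; under eq_bigr do rewrite !WE.
  - move=> i j; have := h5 i j; under eq_bigr do rewrite !WE.
    by under [X in _ = X -> _]eq_bigr do rewrite !WE.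
split=> [[h1 h2 h3 h4 h5]|[[h1 h2 h3 h4] h5]].
  split; last by apply/matrixP => i j; rewrite mulE_emb mul_embE; exact: h5.
  split.
  - apply/matrixP => i j; rewrite mxE -delta_scale -h1.
    by apply: eq_bigr => k _; rewrite dagE.
  - apply/matrixP => i j; rewrite mxE -delta_scale -h2.
    by apply: eq_bigr => k _; rewrite dagE.
  - move=> p k l; have := h3 p k l.
    under eq_bigr do under eq_bigr do rewrite frame_muE.
    by under [X in _ = X -> _]eq_bigr do rewrite frame_muE.
  - by apply/matrixP => i j; rewrite (ord1 j) mulE_emb embE.
split.
- move=> i j; rewrite delta_scale -h1 mxE.
  by apply: eq_bigr => k _; rewrite dagE.
- move=> i j; rewrite delta_scale -h2 mxE.
  by apply: eq_bigr => k _; rewrite dagE.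
- move=> p k l; under eq_bigr do under eq_bigr do rewrite frame_muE.
  by under [RHS]eq_bigr do rewrite frame_muE; exact: h3.
- by move=> i; have /matrixP/(_ i 0) := h4; rewrite mulE_emb embE.
- by move=> i j; have /matrixP/(_ i j) := h5; rewrite mulE_emb mul_embE.
Qed.

End QutRel.

(** Covers the zero algebra, which [carrier] excludes. From x = 1 x = 0 x follows x + x = x. *)
Lemma star_alg_trivial (R : realType) (B : starOps R) :
  is_star_alg B -> sa_one B = sa_zero B -> forall x y : sa_car B, x = y.
Proof.
move=> [[addA [addC [add0 [addN [sc1 [_ [_ scD]]]]]]] [[_ [mul1 [_ [mulD _]]]]
  _]] one0.
suff Z x : x = sa_zero B by move=> x y; rewrite (Z x) (Z y).
have E : sa_add x x = x.
  by rewrite -{1 2 3}(mul1 x) one0 -mulD add0.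
by rewrite -(addN x) -{2}E -addA addN addC add0.
Qed.

(** * The coproduct as a matrix over C(G) *)

Section Coproduct.
Variables (R : realType) (G : fqgroup R).
Local Notation C := R[i].
Local Notation d := (fqg_dim G).
Local Notation A := (fqg_alg G).
Local Notation D := (fqg_Delta G).
(* [F] is C(G) itself, transported along [of_] from its coordinates. *)
Variables (F : frame R d) (of_ : F -> 'cV[C]_d) (to_ : 'cV[C]_d -> F).
Hypothesis of_lin : linear of_.
Hypothesis to_K : cancel to_ of_.
Hypothesis of_K : cancel of_ to_.
Hypothesis ofM : forall x y, of_ (x * y) = fd_mul A (of_ x) (of_ y).
Hypothesis of_st : forall x, of_ (st x) = fd_star A (of_ x).
Hypothesis of1 : of_ 1 = fd_unit A.
Local Notation ee := (@fe R d F).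

Let E (q : 'I_d) : F := to_ (ev R q).
Let ofE q : of_ (E q) = ev R q. Proof. exact: to_K. Qed.

Let ofD x y : of_ (x + y) = of_ x + of_ y.
Proof. by rewrite -[x in LHS]scale1r of_lin scale1r. Qed.
Let of0 : of_ 0 = 0.
Proof. by apply: (addrI (of_ 0)); rewrite -ofD !addr0. Qed.
Let ofZ a x : of_ (a *: x) = a *: of_ x.
Proof. by rewrite -[a *: x]addr0 of_lin of0 addr0. Qed.
Let of_sum (I : finType) (f : I -> F) : of_ (\sum_i f i) = \sum_i of_ (f i).
Proof. exact: (big_morph of_ ofD of0). Qed.

Lemma coord_exp (x : F) : x = \sum_q of_ x q 0 *: E q.
Proof.
apply: (can_inj of_K); rewrite of_sum.
apply/matrixP => i j; rewrite (ord1 j) summxE (bigD1 i) //= big1 ?addr0.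
  by rewrite ofZ ofE !mxE !eqxx mulr1.
by move=> k ki; rewrite ofZ ofE !mxE eq_sym (negbTE ki) mulr0.
Qed.

Lemma scalar_coord (w : F -> C) : scalar w ->
  forall x : F, w x = \sum_q of_ x q 0 * w (E q).
Proof.
move=> wl x; have wD y z : w (y + z) = w y + w z.
  by rewrite -[y in LHS]scale1r wl mul1r.
have w0 : w 0 = 0 by apply: (addrI (w 0)); rewrite -wD !addr0.
have wZ a y : w (a *: y) = a * w y by rewrite -[a *: y]addr0 wl w0 addr0.
rewrite {1}(coord_exp x) (big_morph w wD w0).
by apply: eq_bigr => q _; rewrite wZ.
Qed.

(* (w (x) id) z *)
Definition slice (w : F -> C) (z : 'cV[C]_(d * d)) : F :=
  \sum_p \sum_q (z (mxvec_index p q) 0 * w (E p)) *: E q.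

Lemma slice_linear w : linear (slice w).
Proof.
move=> a y z; rewrite /slice scaler_sumr -big_split; apply: eq_bigr => p _ /=.
rewrite scaler_sumr -big_split; apply: eq_bigr => q _ /=.
by rewrite !mxE mulrDl scalerDl scalerA mulrA.
Qed.

Lemma sliceD w y z : slice w (y + z) = slice w y + slice w z.
Proof. by rewrite -[y in LHS]scale1r slice_linear scale1r. Qed.
Lemma slice0 w : slice w 0 = 0.
Proof. by apply: (addrI (slice w 0)); rewrite -sliceD !addr0. Qed.
Lemma sliceZ w a y : slice w (a *: y) = a *: slice w y.
Proof. by rewrite -[a *: y]addr0 slice_linear slice0 addr0. Qed.
Lemma slice_sum w (I : finType) (f : I -> 'cV[C]_(d * d)) :
  slice w (\sum_i f i) = \sum_i slice w (f i).
Proof. exact: (big_morph _ (sliceD w) (slice0 w)). Qed.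

Lemma slice_tens w (x y : F) : scalar w -> slice w (tens (of_ x) (of_ y)) =
  w x *: y.
Proof.
move=> wl; rewrite (scalar_coord wl x) scaler_suml {2}(coord_exp y).
apply: eq_bigr => p _; rewrite scaler_sumr; apply: eq_bigr => q _.
by rewrite tensE scalerA mulrAC.
Qed.

Lemma slice_exp w z : scalar w ->
  slice w z = \sum_i w (ee i) *: slice (co (F := F) i) z.
Proof.
move=> wl; under [RHS]eq_bigr do rewrite scaler_sumr.
rewrite exchange_big; apply: eq_bigr => p _ /=.
under [RHS]eq_bigr do rewrite scaler_sumr.
rewrite exchange_big; apply: eq_bigr => q _ /=.
under [RHS]eq_bigr do rewrite scalerA.
rewrite -scaler_suml; congr (_ *: _).
rewrite [w (E p)](co_lift (U := C^o) wl) mulr_sumr; apply: eq_bigr => i _.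
by rewrite -[_ *: _]/(_ * _); ring.
Qed.

Let slice_scalar i : scalar (co (F := F) i).
Proof. exact: co_scalar. Qed.

Lemma slice_mul2 w y z : scalar w -> slice w (fqg_mul2 y z) =
  \sum_i \sum_j w (ee i * ee j)
     *: (slice (co (F := F) i) y * slice (co (F := F) j) z).
Proof.
move=> wl.
have wE (a b : F) : w (a * b) = \sum_i \sum_j
    (co (F := F) i a * co (F := F) j b) * w (ee i * ee j).
  have wla : scalar (fun x : F => w (x * b)).
    by move=> c x x'; rewrite mulrDl -scalerAl wl.
  have wlb (x : F) : scalar (fun y : F => w (x * y)).
    by move=> c x1 x2; rewrite mulrDr -scalerAr wl.
  rewrite [LHS](co_lift (U := C^o) wla); apply: eq_bigr => i _.
  rewrite [w _](co_lift (U := C^o) (wlb _)) scaler_sumr; apply: eq_bigr => j _.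
  by rewrite -[LHS]/(_ * (_ * _)) mulrA.
rewrite /fqg_mul2.
transitivity (\sum_a \sum_b \sum_a' \sum_b'
    (y (mxvec_index a b) 0 * z (mxvec_index a' b') 0) *:
      (w (E a * E a') *: (E b * E b'))).
  rewrite slice_sum; apply: eq_bigr => a _.
  rewrite slice_sum; apply: eq_bigr => b _.
  rewrite slice_sum; apply: eq_bigr => a' _.
  rewrite slice_sum; apply: eq_bigr => b' _.
  by rewrite sliceZ -!ofE -!ofM slice_tens.
transitivity (\sum_a \sum_b \sum_a' \sum_b' \sum_i \sum_j
   w (ee i * ee j) *:
     (((y (mxvec_index a b) 0 * co (F := F) i (E a)) *: E b) *
      ((z (mxvec_index a' b') 0 * co (F := F) j (E a')) *: E b'))).
  apply: eq_bigr => a _; apply: eq_bigr => b _; apply: eq_bigr => a' _.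
  apply: eq_bigr => b' _; rewrite wE scaler_suml scaler_sumr.
  apply: eq_bigr => i _; rewrite scaler_suml scaler_sumr.
  apply: eq_bigr => j _.
  rewrite -[in RHS]scalerAr -[in RHS]scalerAl !scalerA.
  by congr (_ *: _); ring.
under eq_bigr do under eq_bigr do under eq_bigr do rewrite exchange_big.
under eq_bigr do under eq_bigr do rewrite exchange_big.
under eq_bigr do rewrite exchange_big.
rewrite exchange_big; apply: eq_bigr => i _ /=.
under eq_bigr do under eq_bigr do under eq_bigr do rewrite exchange_big.
under eq_bigr do under eq_bigr do rewrite exchange_big.
under eq_bigr do rewrite exchange_big.
rewrite exchange_big; apply: eq_bigr => j _ /=.
rewrite /slice mulr_suml scaler_sumr; apply: eq_bigr => a _.
rewrite mulr_suml scaler_sumr; apply: eq_bigr => b _.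
rewrite mulr_sumr scaler_sumr; apply: eq_bigr => a' _.
by rewrite mulr_sumr scaler_sumr.
Qed.

Lemma slice_mul2_tens w z (x y : F) : scalar w ->
  slice w (fqg_mul2 z (tens (of_ x) (of_ y))) = slice (fun s =>
    w (s * x)) z * y.
Proof.
move=> wl; have wlx : scalar (fun s : F => w (s * x)).
  by move=> c x1 x2; rewrite mulrDl -scalerAl wl.
rewrite slice_mul2 // slice_exp // mulr_suml; apply: eq_bigr => i _.
have wli : scalar (fun s : F => w (ee i * s)).
  by move=> c x1 x2; rewrite mulrDr -scalerAr wl.
rewrite [w _](co_lift (U := C^o) wli) -scalerAl scaler_suml.
apply: eq_bigr => j _; rewrite slice_tens //.
by rewrite -scalerAr scalerA mulrC.
Qed.

Lemma slice_star2 i z : slice (co (F := F) i) (fqg_star2 z) =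
  \sum_s co (F := F) i (st (ee s)) *: st (slice (co (F := F) s) z).
Proof.
transitivity (\sum_a \sum_b Num.conj (z (mxvec_index a b) 0) *:
    (co (F := F) i (st (E a)) *: st (E b))).
  rewrite slice_sum; apply: eq_bigr => a _.
  rewrite slice_sum; apply: eq_bigr => b _.
  by rewrite sliceZ -!ofE -!of_st slice_tens.
under [RHS]eq_bigr do rewrite st_sum scaler_sumr.
rewrite [RHS]exchange_big; apply: eq_bigr => a _ /=.
under [RHS]eq_bigr do rewrite st_sum scaler_sumr.
rewrite [RHS]exchange_big; apply: eq_bigr => b _ /=.
under [RHS]eq_bigr do rewrite stZ scalerA.
rewrite -scaler_suml scalerA; congr (_ *: _).
rewrite {1}(co_exp (E a)) st_sum co_sum mulr_sumr; apply: eq_bigr => s _.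
by rewrite stZ coZ rmorphM /=; ring.
Qed.

Definition coprod_mx : 'M[F]_d :=
  \matrix_(i, j) slice (co (F := F) i) (D *m of_ (ee j)).
Local Notation u := coprod_mx.

Lemma slice_Delta w (x : F) : scalar w ->
  slice w (D *m of_ x) =
  \sum_i w (ee i) *: \sum_k co k x *: u i k.
Proof.
move=> wl; rewrite slice_exp //; apply: eq_bigr => i _; congr (_ *: _).
have lin : linear (fun y : F => slice (co (F := F) i) (D *m of_ y)).
  move=> a y z; rewrite -slice_linear; congr (slice _ _).
  by rewrite of_lin mulmxDr -scalemxAr.
by rewrite (co_lift lin); apply: eq_bigr => k _; rewrite mxE.
Qed.

Lemma slice_Delta_co i (x : F) :
  slice (co (F := F) i) (D *m of_ x) = \sum_k co k x *: u i k.
Proof.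
rewrite slice_Delta // (bigD1 i) //= co_e eqxx scale1r [X in _ + X]big1 ?addr0
  // => j ji.
by rewrite co_e eq_sym (negbTE ji) scale0r.
Qed.


Hypothesis D_unit : D *m fd_unit A = tens (fd_unit A) (fd_unit A).
Hypothesis D_mul : forall x y, D *m fd_mul A x y = fqg_mul2 (D *m x) (D *m y).
Hypothesis D_st : forall x, D *m fd_star A x = fqg_star2 (D *m x).
Hypothesis D_coassoc : forall a p q r : 'I_d,
  \sum_(i < d) Dc a i r * Dc i p q = \sum_(j < d) Dc a p j * Dc j q r.
Hypothesis D_cancel1 : forall z : 'cV[C]_(d * d), exists c : 'M[C]_d,
  z = \sum_(a < d) \sum_(b < d)
        c a b *: fqg_mul2 (D *m ev R a) (tens (fd_unit A) (ev R b)).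
Hypothesis D_cancel2 : forall z : 'cV[C]_(d * d), exists c : 'M[C]_d,
  z = \sum_(a < d) \sum_(b < d)
        c a b *: fqg_mul2 (D *m ev R a) (tens (ev R b) (fd_unit A)).

(** Coassociativity is given in the standard basis; [dual], the completeness of the basis [ee]
    against its coordinate functionals, carries it over to u. *)
Lemma coprod_mxP i j :
  D *m of_ (u i j) = \sum_k tens (of_ (u i k)) (of_ (u k j)).
Proof.
have uE k l q : of_ (u k l) q 0
    = \sum_p \sum_b Dc b p q * of_ (ee l) b 0 * co k (E p).
  rewrite mxE /slice of_sum summxE; apply: eq_bigr => p _.
  rewrite of_sum summxE (bigD1 q) //= big1 ?addr0 => [|q' q'q]; last first.
    by rewrite ofZ ofE !mxE [q == _]eq_sym (negbTE q'q) mulr0.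
  by rewrite ofZ ofE mxE [X in _ * X]mxE !eqxx mulr1 mxE mulr_suml.
have dual b p : \sum_k of_ (ee k) b 0 * co k (E p) = (b == p)%:R.
  have := congr1 (fun x => of_ x b 0) (co_exp (E p)).
  rewrite of_sum summxE ofE mxE eqxx andbT => ->.
  by apply: eq_bigr => k _; rewrite ofZ mxE mulrC.
apply/matrixP => s z; rewrite (ord1 z); case/mxvec_indexP: s => r s.
rewrite mxE summxE.
transitivity (\sum_p \sum_b (\sum_a Dc b p a * Dc a r s)
                 * of_ (ee j) b 0 * co i (E p)).
  under eq_bigr do rewrite uE mulr_sumr.
  rewrite exchange_big; apply: eq_bigr => p _ /=.
  under eq_bigr do rewrite mulr_sumr.
  rewrite exchange_big; apply: eq_bigr => b _ /=.
  rewrite !mulr_suml; apply: eq_bigr => a _.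
  by rewrite /Dc; ring.
transitivity (\sum_p \sum_b (\sum_t Dc b t s * Dc t p r)
                 * of_ (ee j) b 0 * co i (E p)).
  by apply: eq_bigr => p _; apply: eq_bigr => b _; rewrite D_coassoc.
symmetry.
transitivity (\sum_k \sum_p \sum_a \sum_t \sum_b
   (Dc b t s * Dc a p r * of_ (ee j) b 0 * co i (E p))
     * (of_ (ee k) a 0 * co k (E t))).
  apply: eq_bigr => k _; rewrite tensE !uE mulr_suml; apply: eq_bigr => p _.
  rewrite mulr_suml; apply: eq_bigr => a _; rewrite mulr_sumr.
  apply: eq_bigr => t _; rewrite mulr_sumr; apply: eq_bigr => b _.
  by ring.
rewrite exchange_big; apply: eq_bigr => p _ /=.
transitivity (\sum_a \sum_t \sum_b
   (Dc b t s * Dc a p r * of_ (ee j) b 0 * co i (E p)) * (a == t)%:R).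
  rewrite exchange_big; apply: eq_bigr => a _ /=.
  rewrite exchange_big; apply: eq_bigr => t _ /=.
  rewrite exchange_big; apply: eq_bigr => b _ /=.
  by rewrite -mulr_sumr dual.
rewrite exchange_big /=.
under [RHS]eq_bigr do rewrite !mulr_suml.
rewrite [RHS]exchange_big; apply: eq_bigr => t _ /=.
rewrite (bigD1 t) //= [X in _ + X]big1 ?addr0 => [|a at_]; last first.
  by rewrite big1 // => b _; rewrite (negbTE at_) mulr0.
by apply: eq_bigr => b _; rewrite eqxx mulr1.
Qed.

Lemma slice_tau_coprod x : slice_tau u x = slice tau (D *m of_ x).
Proof.
rewrite slice_Delta; last exact: tau_scalar.
rewrite /slice_tau; under eq_bigr do rewrite scaler_sumr.
rewrite exchange_big; apply: eq_bigr => i _ /=.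
rewrite scaler_sumr; apply: eq_bigr => k _.
by rewrite !scalerA mulrC.
Qed.

Lemma coprod_cancel1 : exists u' : 'M[F]_d, u *m u' = 1%:M.
Proof.
have [c Hc] := boolp.choice (fun k : 'I_d =>
  D_cancel1 (tens (of_ (ee k)) (of_ 1))).
(* If e_k (x) 1 is the sum of c_ab Delta (E_a) (1 (x) E_b), then u maps the sum of c_ab E_a (x) E_b
   to it; that element is column k. *)
exists (\matrix_(m, k) \sum_a \sum_b (c k a b * co m (E a)) *: E b).
apply/matrixP => i k; rewrite mxE.
have := congr1 (slice (co i)) (Hc k); rewrite slice_tens // co_e => H.
transitivity ((i == k)%:R *: (1 : F)); last first.
  by rewrite mxE; case: (i == k); rewrite ?scale1r ?scale0r.
rewrite H slice_sum.
under [LHS]eq_bigr do rewrite [X in _ * X]mxE mulr_sumr.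
rewrite exchange_big; apply: eq_bigr => a _ /=; rewrite slice_sum.
under eq_bigr do rewrite mulr_sumr.
rewrite exchange_big; apply: eq_bigr => b _ /=.
have wl : scalar (fun s : F => co i (s * 1)).
  by move=> x y z; rewrite mulrDl -scalerAl coD coZ.
rewrite sliceZ -of1 -!ofE slice_mul2_tens //.
have -> : slice (fun s : F => co i (s * 1)) (D *m of_ (E a))
    = slice (co i) (D *m of_ (E a)).
  by apply: eq_bigr => p _; apply: eq_bigr => q _; rewrite mulr1.
rewrite slice_Delta_co mulr_suml scaler_sumr; apply: eq_bigr => m _.
by rewrite -scalerAr -scalerAl scalerA.
Qed.

Lemma coprod_cancel2 (y : F) : exists z : 'I_d -> F,
  forall w : F -> C, scalar w ->
    w 1 *: y = \sum_l \sum_j w (ee j * z l) *: u j l.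
Proof.
have [c Hc] := D_cancel2 (tens (of_ 1) (of_ y)).
(* 1 (x) y is the sum of c_ab Delta (E_a) (E_b (x) 1); z l collects the E_b, weighted by c_ab and
   the l-th coordinate of E_a. *)
exists (fun l => \sum_a \sum_b (c a b * co l (E a)) *: E b) => w wl.
have wD s x : w (s + x) = w s + w x by rewrite -[s in LHS]scale1r wl mul1r.
have w0 : w 0 = 0 by apply: (addrI (w 0)); rewrite -wD !addr0.
have wZ a s : w (a *: s) = a * w s by rewrite -[a *: s]addr0 wl w0 addr0.
have w_sum (f : 'I_d -> F) : w (\sum_i f i) = \sum_i w (f i).
  exact: (big_morph w wD w0).
rewrite -slice_tens // Hc slice_sum.
transitivity (\sum_l \sum_j \sum_a \sum_b
    (c a b * co l (E a) * w (ee j * E b)) *: u j l); last first.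
  apply: eq_bigr => l _; apply: eq_bigr => j _.
  rewrite mulr_sumr w_sum scaler_suml; apply: eq_bigr => a _.
  rewrite mulr_sumr w_sum scaler_suml; apply: eq_bigr => b _.
  by rewrite -scalerAr wZ.
under [RHS]eq_bigr do rewrite exchange_big.
rewrite [RHS]exchange_big; apply: eq_bigr => a _ /=; rewrite slice_sum.
under [RHS]eq_bigr do rewrite exchange_big.
rewrite [RHS]exchange_big; apply: eq_bigr => b _ /=.
have wlb : scalar (fun s : F => w (s * E b)).
  by move=> x s r; rewrite mulrDl -scalerAl wl.
rewrite sliceZ -of1 -!ofE slice_mul2_tens // mulr1 slice_Delta //.
rewrite scaler_sumr [RHS]exchange_big; apply: eq_bigr => j _ /=.
rewrite !scaler_sumr; apply: eq_bigr => l _.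
by rewrite !scalerA; congr (_ *: _); ring.
Qed.

Lemma coprod_hopf : hopf u.
Proof.
split; [ | | | | exact: coprod_cancel1 | exact: coprod_cancel2].
- move=> p k l; rewrite -slice_Delta_co ofM D_mul slice_mul2 //.
  apply: eq_bigr => i _; apply: eq_bigr => j _.
  by rewrite !mxE.
- apply/matrixP => i j; rewrite mulE_emb embE.
  have := slice_Delta_co i 1; rewrite of1 D_unit -of1 slice_tens // mxE => ->.
  by apply: eq_bigr => k _; rewrite mxE.
- move=> j k; rewrite slice_tau_coprod ofM D_mul of_st D_st.
  rewrite slice_mul2; last exact: tau_scalar.
  transitivity (\sum_a \sum_b \sum_s (tau (ee a * ee b) * co a (st (ee s)))
      *: (st (u s j) * u b k)); last first.
    apply: eq_bigr => a _; apply: eq_bigr => b _.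
    rewrite slice_star2 mulr_suml scaler_sumr; apply: eq_bigr => s _.
    by rewrite -scalerAl scalerA !mxE.
  rewrite exchange_big /=.
  under [RHS]eq_bigr do rewrite exchange_big.
  rewrite [RHS]exchange_big; apply: eq_bigr => s _ /=.
  transitivity (\sum_b (s == b)%:R *: (st (u s j) * u b k)).
    rewrite (bigD1 s) //= eqxx scale1r big1 ?addr0 // => b bs.
    by rewrite eq_sym (negbTE bs) scale0r.
  apply: eq_bigr => b _; rewrite -scaler_suml; congr (_ *: _).
  under eq_bigr do rewrite tauC.
  by rewrite parseval tauC tau_onb.
- move=> i p q; rewrite -slice_Delta_co coprod_mxP slice_sum.
  by apply: eq_bigr => r _; rewrite slice_tens.
Qed.

End Coproduct.

Theorem theorem5p5 (R : realType) (G : fqgroup R) :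
  is_fqgroup G ->
  exists (n : nat) (X : fdalg R n) (A : 'M[R[i]]_n)
         (u : 'I_n -> 'I_n -> 'cV[R[i]]_(fqg_dim G)),
    [/\ is_qset X, is_undirected_qgraph X A,
        is_graph_action G X A u, action_faithful G u &
        action_universal G X A u].
Proof.
move=> [hA unit_neq0 [h hpos] [D_unit D_mul D_st] [D_coassoc [D_c1 D_c2]]].
have nz : sa_one (fd_ops (fqg_alg G)) <> sa_zero (fd_ops (fqg_alg G)).
  by move=> H; case/eqP: unit_neq0.
pose H := carrier_star hA nz.
have hlin : scalar (fun x : H => (h *m (x : 'cV[R[i]]_(fqg_dim G))) 0 0).
  move=> a x y; rewrite -[a *: x + y]/(a *: (x : 'cV[R[i]]_(fqg_dim G)) + (y :
    'cV[R[i]]_(fqg_dim G))).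
  by rewrite mulmxDr -scalemxAr !mxE.
have ev_sum (s : 'I_(fqg_dim G) -> R[i]) i :
    (\sum_k s k *: ev R k) i 0 = s i.
  rewrite summxE (bigD1 i) //= big1 ?addr0 => [|k ki].
    by rewrite !mxE !eqxx mulr1.
  by rewrite !mxE eq_sym (negbTE ki) mulr0.
have b_exp (x : H) : x = \sum_i (x : 'cV[R[i]]_(fqg_dim G)) i 0 *: (ev R i : H).
  apply: (_ : (x : 'cV[R[i]]_(fqg_dim G)) =
    \sum_i (x : 'cV[R[i]]_(fqg_dim G)) i 0 *: ev R i).
  by apply/matrixP => i j; rewrite (ord1 j) ev_sum.
have b_free (s : 'I_(fqg_dim G) -> R[i]) :
    \sum_i s i *: (ev R i : H) = 0 -> forall i, s i = 0.
  move=> H0 i; have {}H0 : \sum_i s i *: ev R i = 0 by exact: H0.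
  by rewrite -(ev_sum s i) H0 mxE.
have hpos' (x : H) : x != 0 ->
    0 < (h *m ((st x * x : H) : 'cV[R[i]]_(fqg_dim G))) 0 0.
  by move=> /eqP x0; apply: hpos; apply/eqP.
have [t [e [t_lin tC t_st [t_onb t_exp t_trace]]]] :=
  @trace_frame R H _ _ _ _ hlin hpos' b_exp b_free.
pose F := Frame t_lin tC t_st t_onb t_exp t_trace.
(* Both maps are the identity; naming them keeps apart the coordinate vectors and the algebra
   carried by the same type. *)
pose of_ (x : F) : 'cV[R[i]]_(fqg_dim G) := x.
pose to_ (x : 'cV[R[i]]_(fqg_dim G)) : F := x.
have of_lin : linear of_ by [].
have to_K : cancel to_ of_ by [].
have of_K : cancel of_ to_ by [].
have ofM x y : of_ (x * y) = fd_mul (fqg_alg G) (of_ x) (of_ y) by [].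
have of_st x : of_ (st x) = fd_star (fqg_alg G) (of_ x) by [].
have of1 : of_ 1 = fd_unit (fqg_alg G) by [].
pose u := coprod_mx of_ to_.
have hu : hopf u by exact: coprod_hopf.
have uP := coprod_mxP of_lin to_K D_coassoc.
have [s [s_proj s_span]] := projections_span F.
pose k0 : bool * 'I_(size s).+1 := (true, ord0).
pose U := pow_mx u s.
exists (pow_dim _ _), (frame_alg (pow_frame F k0)), (graph_mx u s).
exists (fun a b => of_ (U a b)).
have Uidx i j : U (idx k0 i) (idx k0 j) = u i j.
  by rewrite /U pow_mx_idx lay_idx eqxx pos_idx.
split.
- exact: frame_qset.
- exact: graph_undirected.
- split.
    apply/(qut_relP _ hA nz).
    have -> : \matrix_(a, b) (of_ (U a b) : H) = U.
      by apply/matrixP => a b; rewrite mxE.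
    by split; [exact: (pow_mx_qperm hu) | exact: (pow_mx_intertwines hu)].
  move=> a b.
  rewrite (@sum_pow_mx _ _ F u s _ a (fun x c => tens (of_ x) (of_ (U c b))));
    last first.
    move=> c; apply/matrixP; case/mxvec_indexP => i j k.
    by rewrite tensE !mxE mul0r.
  rewrite /U [pow_mx u s a b]mxE; have [ab|ab] := eqVneq (lay a) (lay b).
    rewrite uP; apply: eq_bigr => k _.
    by rewrite pow_mx_idx ab eqxx.
  rewrite -[of_ 0]/(0 : 'cV[R[i]]_(fqg_dim G)) mulmx0 big1 // => k _.
  rewrite pow_mx_idx [lay b == _]eq_sym (negbTE ab).
  apply/matrixP; case/mxvec_indexP => i j l.
  by rewrite tensE !mxE mulr0.
(* The copy k0 alone contains all entries of u, and these already span C(G). *)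
- move=> P P1 PD PZ PM; apply: (hopf_ind hu) => // i j.
  have [] := PM (idx k0 i) (idx k0 j) _ P1.
  by rewrite Uidx -of1 -ofM mulr1.
- move=> B hB V hV.
  (* In the zero algebra all elements coincide and any map will do; otherwise [carrier_star] applies
     to B. *)
  have [one0|nzB] := pselect (sa_one B = sa_zero B).
    have triv := star_alg_trivial hB one0.
    by exists (fun _ => sa_zero B); split=> [|a b]; [split=> * |]; exact: triv.
  have [qV V_graph] := (qut_relP _ hB nzB _ _).1 hV.
  have [pi [pi_lin pi_mul pi_st pi_1 pi_U]] :=
    graph_factor hu s_span qV V_graph.
  exists pi; split; last by move=> a b; rewrite pi_U mxE.
  have piD x y : pi (x + y) = pi x + pi y.
    by rewrite -[x in LHS]scale1r pi_lin scale1r.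
  have pi0 : pi 0 = 0 by apply: (addrI (pi 0)); rewrite -piD !addr0.
  split=> //.
  by move=> a x; have := pi_lin a x 0; rewrite pi0 !addr0.
Qed.
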